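(* Let $\Omega\subset\mathbb{R}$ be an open set and let $f:\Omega\times\mathbb{R}\times\mathbb{R}\to[0,+\infty)$, $(x,s,\xi)\mapsto f(x,s,\xi)$, satisfy: (H1) $f$ is continuous on $\Omega\times\mathbb{R}\times\mathbb{R}$, and for every $(x,s)\in\Omega\times\mathbb{R}$ the map $\xi\mapsto f(x,s,\xi)$ is convex on $\mathbb{R}$; (H4) on every compact set $\Omega'\times H\times K\subset\Omega\times\mathbb{R}\times\mathbb{R}$, $f$ is absolutely continuous in $x$, uniformly in $(s,\xi)$: for every $\varepsilon>0$ there is $\delta>0$ such that for every $(s,\xi)\in H\times K$ and every finite family of pairwise disjoint open intervals $(a_i,b_i)\subset\Omega'$, $i=1,\dots,N$, with $\sum_i(b_i-a_i)<\delta$, one has $\sum_i|f(b_i,s,\xi)-f(a_i,s,\xi)|<\varepsilon$. Then the functional $F(u,\Omega)=\int_\Omega f(x,u(x),u'(x))\,dx$ is lower semicontinuous on $W^{1,1}_{loc}(\Omega)$ with respect to strong convergence in $L^1_{loc}(\Omega)$: whenever $u_m,u\in W^{1,1}_{loc}(\Omega)$ and $u_m\to u$ in $L^1_{loc}(\Omega)$, we have $\liminf_{m\to\infty}F(u_m,\Omega)\ge F(u,\Omega)$.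
   Context: $W^{1,1}_{loc}(\Omega)$ denotes the functions $u\in L^1_{loc}(\Omega)$ whose weak derivative $u'$ lies in $L^1_{loc}(\Omega)$. Convergence $u_m\to u$ in $L^1_{loc}(\Omega)$ means $\|u_m-u\|_{L^1(K)}\to0$ for every compact $K\subset\Omega$. The integral $F(u,\Omega)$ takes values in $[0,+\infty]$. *)

(* Defs.v *)
From HB Require Import structures.
From mathcomp Require Import all_boot all_order all_algebra.
From mathcomp Require Import all_classical all_reals all_analysis.
Set Implicit Arguments. Unset Strict Implicit. Unset Printing Implicit Defensive.
Import Order.TTheory GRing.Theory Num.Theory.
Import numFieldNormedType.Exports.
Local Open Scope classical_set_scope.
Local Open Scope ring_scope.

Section Defs.
Variable R : realType.
Local Notation mu := (@lebesgue_measure R).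

Definition smooth (phi : R -> R) : Prop :=
  forall (n : nat) (x : R), derivable (iter n (fun g : R -> R => derive1 g) phi) x 1.

Definition test_fun (Omega : set R) (phi : R -> R) : Prop :=
  smooth phi /\
  exists K : set R, [/\ compact K, K `<=` Omega & forall x, ~ K x -> phi x = 0].

Definition loc_integrable (Omega : set R) (u : R -> R) : Prop :=
  forall K : set R, compact K -> K `<=` Omega -> mu.-integrable K (EFin \o u).

Definition weak_deriv (Omega : set R) (u v : R -> R) : Prop :=
  loc_integrable Omega u /\ loc_integrable Omega v /\
  forall phi, test_fun Omega phi ->
    (\int[mu]_(x in Omega) (u x * derive1 phi x)%:E =
     - \int[mu]_(x in Omega) (v x * phi x)%:E)%E.

Definition L1loc_cvg (Omega : set R) (us : nat -> R -> R) (u : R -> R) : Prop :=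
  forall K : set R, compact K -> K `<=` Omega ->
    (fun m => (\int[mu]_(x in K) (`|us m x - u x|)%:E)%E) @ \oo --> 0%E.

(* F(u, Omega) = int_Omega f(x, u(x), u'(x)) dx, u' a weak derivative of u *)
Definition Ffun (f : R -> R -> R -> R) (Omega : set R) (u du : R -> R) : \bar R :=
  (\int[mu]_(x in Omega) (f x (u x) (du x))%:E)%E.

Definition H1 (Omega : set R) (f : R -> R -> R -> R) : Prop :=
  {within Omega `*` setT `*` setT,
     continuous (fun p : R * R * R => f p.1.1 p.1.2 p.2)} /\
  forall x s, Omega x -> forall (xi1 xi2 t : R), 0 <= t <= 1 ->
    f x s (t * xi1 + (1 - t) * xi2) <= t * f x s xi1 + (1 - t) * f x s xi2.

Definition H4 (Omega : set R) (f : R -> R -> R -> R) : Prop :=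
  forall O' H K : set R, compact O' -> O' `<=` Omega -> compact H -> compact K ->
  forall eps : R, 0 < eps -> exists2 delta : R, 0 < delta &
    forall s xi, H s -> K xi ->
    forall (N : nat) (a b : nat -> R),
      (forall i, (i < N)%N -> a i < b i /\ `]a i, b i[ `<=` O') ->
      (forall i j, (i < N)%N -> (j < N)%N -> i <> j ->
          `]a i, b i[ `&` `]a j, b j[ = set0) ->
      \sum_(i < N) (b i - a i) < delta ->
      \sum_(i < N) `|f (b i) s xi - f (a i) s xi| < eps.
End Defs.

(* Main.v *)
Require Import Defs.
From HB Require Import structures.
From mathcomp Require Import all_boot all_order all_algebra.
From mathcomp Require Import all_classical all_reals all_analysis.
From mathcomp Require Import measurable_realfun.
From mathcomp Require Import ring lra zify.
Import Order.TTheory GRing.Theory Num.Theory.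
Import numFieldNormedType.Exports.
Local Open Scope classical_set_scope.
Local Open Scope ring_scope.
Set Implicit Arguments.
Unset Strict Implicit.
Unset Printing Implicit Defensive.

(**
On a small cell, convexity gives, for a fixed xi and up to a small error, the
minorant f(x, s, z) >= f(x, s, xi) + q(x, s) (z - xi), where the difference
quotient q(x, s) = (f(x, s, xi + r) - f(x, s, xi)) / r inherits the absolute
continuity of f in x. Since f >= 0, the minorant may be multiplied by cut-off
functions of x and of s.

The point is that the integral of b(x, w) w' depends continuously on w in L^1,
with no bound at all on w', when b has compact support in s, vanishes for x at
the ends of the cell, and is absolutely continuous in x uniformly in s. If B is
a primitive of b in s, the integral is minus that of B_x(x, w), and
|B_x(x, w1) - B_x(x, w2)| <= int |b_x(x, t)| dt over t between w1 and w2;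
absolute continuity makes the integral of this small when w1 - w2 is small
in L^1. This is carried out on Riemann sums, so that b_x is never formed.

Choosing xi to be a step function close to u' in L^1 yields, on every compact
interval, a lower bound by the integral of f(x, u, u') over {|u'| <= M}; it
remains to exhaust the open set by finite unions of cells, let M tend to infinity,
and apply Fatou's lemma.
*)

(** * Integration on compact intervals *)

(** Convergence in L^1_loc gives no control on the derivatives u_m', whose L^1 norms on a compact
    interval may be unbounded. In every lower bound the constant C is therefore chosen before the
    competitor w, and it multiplies only the L^1 distance from w to u. This is why the minorant is
    affine in z: integrals of b(x, w) w' pass to the limit without a bound on w'.

    The slope is a difference quotient rather than a subgradient because a subgradient need not
    depend continuously on (x, s), let alone absolutely continuously on x. The price is the
    oscillation of f in its last variable over a length r, which uniform continuity makes small once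
    xi stays in a compact set. The truncation |u'| <= M provides this compact set, and also a finite
    integral when F(u) is infinite.

    Riemann sums need point values and increments, whereas u and u_m are only classes with a weak
    derivative. Their absolutely continuous representatives are recovered from smooth test
    functions, whence the explicit smooth step function. *)

Section integration_on_intervals.
Context {R : realType}.
Notation mu := (@lebesgue_measure R).
Implicit Types (f g k : R -> R) (D E : set (measurableTypeR R)).

(** The real-valued integral is [fine] of the extended one, hence 0 when that one is infinite; its
    additivity and monotonicity are used under this hypothesis. *)
Definition itg D f : Prop := mu.-integrable D (EFin \o f).

Lemma itg_measurable D f : itg D f -> measurable_fun D f.
Proof. by case/integrableP => /measurable_EFinP. Qed.

Lemma itgS D E f : measurable D -> measurable E -> D `<=` E -> itg E f -> itg D f.
Proof. by move=> mD mE DE; apply: integrableS. Qed.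

Lemma itgD D f g : measurable D -> itg D f -> itg D g -> itg D (fun x => f x + g x).
Proof.
by move=> mD fi gi; have := integrableD mD fi gi; apply: eq_integrable.
Qed.

Lemma itgB D f g : measurable D -> itg D f -> itg D g -> itg D (fun x => f x - g x).
Proof.
by move=> mD fi gi; have := integrableB mD fi gi; apply: eq_integrable.
Qed.

Lemma itgZ D f (c : R) : measurable D -> itg D f -> itg D (fun x => c * f x).
Proof.
by move=> mD fi; have := integrableZl mD c fi; apply: eq_integrable.
Qed.

Lemma itg_norm D f : itg D f -> itg D (fun x => `|f x|).
Proof. by move=> fi; have := integrable_norm fi. Qed.

Lemma itg_mkcond D f : measurable D -> itg D f <-> itg setT (f \_ D).
Proof.
move=> mD; rewrite /itg -restrict_EFin.
by split => [/(integrable_mkcond _ mD)|h]; last exact/(integrable_mkcond _ mD).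
Qed.

Lemma bounded_onP D f (M : R) : (forall x, D x -> `|f x| <= M) ->
  [bounded f x | x in D].
Proof.
move=> fM; exists M; split; first exact: num_real.
by move=> y My x Dx; apply: (le_trans (fM _ Dx)); exact: ltW.
Qed.

Lemma itg_bounded D f (M : R) : measurable D -> (mu D < +oo)%E ->
  measurable_fun D f -> (forall x, D x -> `|f x| <= M) -> itg D f.
Proof.
move=> mD Dfin mf fM; apply: measurable_bounded_integrable => //.
exact: bounded_onP fM.
Qed.

Lemma itgM D f g (M : R) : measurable D -> measurable_fun D f ->
  (forall x, D x -> `|f x| <= M) -> itg D g -> itg D (fun x => f x * g x).
Proof.
move=> mD mf fM gi.
by have := integrableMr mD mf (bounded_onP fM) gi; apply: eq_integrable.
Qed.

Lemma lty_mu_itv (a b : R) : (mu `[a, b]%classic < +oo)%E.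
Proof. by rewrite lebesgue_measure_itv/=; case: ifP => _; rewrite ?ltry. Qed.
Hint Resolve lty_mu_itv : core.

Lemma itg_continuous (a b : R) f : continuous f -> itg `[a, b]%classic f.
Proof.
move=> cf; apply: continuous_compact_integrable; first exact: segment_compact.
exact: continuous_subspaceT.
Qed.

Lemma itg_cst (a b c : R) : itg `[a, b]%classic (fun=> c).
Proof. by apply: itg_continuous => x; exact: cst_continuous. Qed.

Lemma Rintegral_itv_cst (a b c : R) : a <= b ->
  \int[mu]_(x in `[a, b]) c = c * (b - a).
Proof.
move=> ab; rewrite Rintegral_cst//= lebesgue_measure_itv/= lte_fin.
by move: ab; rewrite le_eqVlt => /predU1P[->|->//]; rewrite ltxx subrr.
Qed.

Lemma sub_itvcc (a b c d : R) : a <= c -> d <= b ->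
  `[c, d]%classic `<=` `[a, b]%classic.
Proof.
by move=> ac db; apply: subset_itv; rewrite bnd_simp.
Qed.

Lemma itg_subitv (a b c d : R) f : a <= c -> d <= b ->
  itg `[a, b]%classic f -> itg `[c, d]%classic f.
Proof. by move=> ac db; apply: itgS => //; exact: sub_itvcc. Qed.

Lemma Rintegral_itv_add (a b c : R) f : a <= c <= b -> itg `[a, b]%classic f ->
  \int[mu]_(x in `[a, b]) f x =
  \int[mu]_(x in `[a, c]) f x + \int[mu]_(x in `[c, b]) f x.
Proof.
move=> /andP[ac cb] fi; apply/eqP; rewrite addrC -subr_eq; apply/eqP.
rewrite (@Rintegral_itvB _ f (BLeft a) (BRight b) c)//.
rewrite Rintegral_itv_obnd_cbnd//.
apply: (@itgS _ `[a, b]%classic f) => //.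
by apply: subset_itv; rewrite bnd_simp.
Qed.

Lemma Rintegral_normr_le (a b M : R) f : a <= b -> itg `[a, b]%classic f ->
  (forall x, a <= x <= b -> `|f x| <= M) ->
  `|\int[mu]_(x in `[a, b]) f x| <= M * (b - a).
Proof.
move=> ab fi fM; apply: (le_trans (le_normr_Rintegral _ fi)) => //.
rewrite -Rintegral_itv_cst//; apply: le_Rintegral => //.
- exact: itg_norm fi.
- exact: itg_cst.
Qed.

Lemma Rintegral_partition (x : nat -> R) f n :
  (forall i, x i <= x i.+1) -> itg `[x 0%N, x n]%classic f ->
  \int[mu]_(t in `[x 0%N, x n]) f t = \sum_(i < n) \int[mu]_(t in `[x i, x i.+1]) f t.
Proof.
move=> ndx; elim: n => [|n IHn] fi.
  by rewrite big_ord0 set_itv1 Rintegral_set1.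
have x0n : x 0%N <= x n.
  by elim: (n) => // m IHm; exact: (le_trans IHm).
rewrite big_ord_recr/= (@Rintegral_itv_add _ _ (x n)) ?x0n ?ndx//.
by rewrite IHn//; apply: itg_subitv fi.
Qed.

Lemma itg_sum D (I : Type) (s : seq I) (F : I -> R -> R) : measurable D ->
  (forall i, itg D (F i)) -> itg D (fun x => \sum_(i <- s) F i x).
Proof.
move=> mD Fi; elim: s => [|i s IHs].
  have -> : (fun x => \sum_(i <- [::]) F i x) = fun=> 0 :> R.
    by apply/funext => x; rewrite big_nil.
  by have := @integrable0 _ _ _ mu D; apply: eq_integrable.
have -> : (fun x => \sum_(j <- i :: s) F j x) =
    (fun x => F i x + \sum_(j <- s) F j x).
  by apply/funext => x; rewrite big_cons.
exact: itgD.
Qed.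

Lemma Rintegral_sum D (I : Type) (s : seq I) (F : I -> R -> R) : measurable D ->
  (forall i, itg D (F i)) ->
  \int[mu]_(x in D) (\sum_(i <- s) F i x) = \sum_(i <- s) \int[mu]_(x in D) F i x.
Proof.
move=> mD Fi; elim: s => [|i s IHs].
  rewrite big_nil (@eq_Rintegral _ _ _ mu D (fun=> 0)); last by move=> x _; rewrite big_nil.
  by rewrite /Rintegral integral0.
rewrite big_cons -IHs -(RintegralD mD (Fi i) (itg_sum s mD Fi)).
by apply: eq_Rintegral => x _; rewrite big_cons.
Qed.

Lemma le_dist_Rintegral D f g h : measurable D ->
  itg D f -> itg D g -> itg D h -> (forall x, D x -> `|f x - g x| <= h x) ->
  `|\int[mu]_(x in D) f x - \int[mu]_(x in D) g x| <= \int[mu]_(x in D) h x.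
Proof.
move=> mD fi gi hi fgh; rewrite -RintegralB//.
apply: (le_trans (le_normr_Rintegral _ _)) => //; first exact: itgB.
by apply: le_Rintegral => //; apply: itg_norm; exact: itgB.
Qed.

End integration_on_intervals.
#[global] Hint Resolve lty_mu_itv : core.

(** * Uniform continuity on compact sets *)

Section compactness.
Context {R : realType}.

(** Heine-Cantor with only one of the two points in K, so that points just outside a compact box may
    be compared with points inside. Compactness is used in its near-covering form, the parameter
    being the radius tending to 0 from the right. *)
Lemma compact_unif_continuous (V : pseudoMetricType R) (K : set V) (h : V -> R) :
  compact K -> continuous h -> forall e, 0 < e ->
  exists2 d : R, 0 < d & forall p q, K p -> ball p d q -> `|h p - h q| < e.
Proof.
move=> cK ch e e0.
have /compact_near_coveringP/(_ R (0^'+)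
  (fun d p => forall q, ball p d q -> `|h p - h q| < e)) := cK.
move=> /(_ (at_right_proper_filter 0))[].
  move=> p Kp; have /cvgrPdist_lt/(_ (e/2)) := ch p.
  rewrite divr_gt0// => /(_ isT)/nbhs_ballP[r /= r0 hr].
  exists (ball p (r/2), [set d | 0 < d < r/2]) => /=.
    split; first by apply: nbhsx_ballx; rewrite divr_gt0.
    near=> d => /=; apply/andP; split; near: d; first exact: nbhs_right_gt.
    by apply: nbhs_right_lt; rewrite divr_gt0.
  move=> [p' d] /= [pp' /andP[d0 dr]] q p'q.
  have h1 : `|h p - h p'| < e/2.
    by apply: hr; apply: le_ball pp'; rewrite ler_pdivrMr// ler_pMr// ler1n.
  have h2 : `|h p - h q| < e/2.
    by apply: hr; rewrite [r]splitr; apply: ball_triangle pp' (le_ball _ p'q); exact: ltW.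
  rewrite [e]splitr (_ : h p' - h q = (h p - h q) - (h p - h p')); last by ring.
  by rewrite (le_lt_trans (ler_normB _ _))// ltrD.
move=> d /= d0 hd; exists (d/2); first by rewrite divr_gt0.
move=> p q Kp; apply: (hd (d/2)) => //=; last by rewrite divr_gt0.
by rewrite sub0r normrN gtr0_norm ?divr_gt0// ltr_pdivrMr// ltr_pMr// ltr1n.
Unshelve. all: by end_near. Qed.

Lemma compact_continuous_bounded (V : pseudoMetricType R) (K : set V) (h : V -> R) :
  compact K -> continuous h ->
  exists2 M : R, 0 <= M & forall p, K p -> `|h p| <= M.
Proof.
move=> cK ch.
have /compact_bounded[N [_ hN]] : compact (h @` K).
  by apply: continuous_compact => //; exact: continuous_subspaceT.
exists (`|N| + 1); first by rewrite addr_ge0.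
by move=> p Kp; apply: hN; [rewrite ltr_pwDr// ler_norm|exists p].
Qed.

End compactness.

(** * Absolutely continuous functions and Riemann sums *)

Section absolutely_continuous_pairs.
Context {R : realType}.
Notation mu := (@lebesgue_measure R).
Implicit Types (w dw k : R -> R) (b : R -> R -> R).

(* [w] is an absolutely continuous function on [c, d] with a.e. derivative [dw];
   outside [c, d] only the continuity of [w] is recorded. *)
Definition acpair (c d : R) w dw : Prop :=
  [/\ continuous w, itg `[c, d]%classic dw &
   forall x y, c <= x -> x <= y -> y <= d ->
     w y - w x = \int[mu]_(t in `[x, y]) dw t].

Lemma acpair_sub (a b c d : R) w dw : a <= c -> d <= b -> acpair a b w dw -> acpair c d w dw.
Proof.
move=> ac db [cw iw wE]; split => //; first exact: itg_subitv iw.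
by move=> x y cx xy yd; apply: wE => //; [exact: le_trans cx|exact: le_trans db].
Qed.

(* For [s < T] the interval is empty and the value is 0, hence the hypotheses
   that [T] lies below the points considered. *)
Definition prim k (T s : R) : R := \int[mu]_(t in `[T, s]) k t.

Lemma primB k (T p q : R) : continuous k -> T <= p -> p <= q ->
  prim k T q - prim k T p = \int[mu]_(t in `[p, q]) k t.
Proof.
move=> ck Tp pq; rewrite /prim (@Rintegral_itv_add _ T q p) ?Tp ?pq//.
  by rewrite addrC addKr.
exact: itg_continuous.
Qed.

Lemma prim_affine k (T p q v e : R) : continuous k -> T <= p -> T <= q ->
  (forall t, (p <= t <= q) || (q <= t <= p) -> `|k t - v| <= e) ->
  `|prim k T q - prim k T p - v * (q - p)| <= e * `|q - p|.
Proof.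
move=> ck.
wlog pq : p q / p <= q.
  move=> H Tp Tq kv; have [/H|/ltW/H] := leP p q; first exact.
  have -> : prim k T q - prim k T p - v * (q - p) =
      - (prim k T p - prim k T q - v * (p - q)) by ring.
  by rewrite normrN [`|q - p|]distrC; apply => // t; rewrite orbC; exact: kv.
move=> Tp Tq kv; rewrite primB// -Rintegral_itv_cst// -RintegralB//; last 2 first.
- exact: itg_continuous.
- exact: itg_cst.
rewrite [`|q - p|]ger0_norm ?subr_ge0//; apply: Rintegral_normr_le => //.
  by apply: itgB => //; [exact: itg_continuous|exact: itg_cst].
by move=> x xpq; apply: kv; rewrite xpq.
Qed.

(** The union of [[p, q]] and [[q, p]] is the segment between p and q in either order. The domain
    [[- S, S]] is independent of p and q, so that later a sum over cells can be exchanged with the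
    integral. *)
Lemma prim_dist_le k (T S p q : R) : continuous k -> T <= p -> T <= q ->
  (forall t, S <= `|t| -> k t = 0) ->
  `|prim k T q - prim k T p| <=
  \int[mu]_(t in `[- S, S]) (\1_(`[p, q] `|` `[q, p]) t * `|k t|).
Proof.
move=> ck.
have mI u v : measurable (`[u, v]%classic : set (measurableTypeR R)) by [].
wlog pq : p q / p <= q.
  move=> H Tp Tq kv; have [/H|/ltW/H] := leP p q; first exact.
  by rewrite distrC setUC; apply.
move=> Tp Tq kS; rewrite primB//.
apply: (le_trans (le_normr_Rintegral _ _)) => //; first exact: itg_continuous.
have kN : continuous (fun t => `|k t|).
  by move=> t; apply: continuous_comp; [exact: ck|exact: norm_continuous].
rewrite Rintegral_mkcond [leRHS]Rintegral_mkcond.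
have mPQ : measurable (`[p, q] `|` `[q, p] : set (measurableTypeR R)).
  exact: measurableU.
apply: le_Rintegral => //.
- by apply: (itg_mkcond _ _).1 => //; exact: (itg_continuous p q kN).
- apply: (itg_mkcond _ _).1 => //.
  apply: (@itgM _ _ _ _ 1 _ _ _ (itg_continuous (- S) S kN)) => //.
  by move=> x _; rewrite indicE ger0_norm//; case: (_ \in _).
move=> x _; rewrite /patch !mem_setE !in_itv/=.
rewrite indicE in_setU !mem_setE !in_itv/=.
case: ifPn => [xpq|xpq]; last by case: ifPn => // _; rewrite mulr_ge0.
have [xS|xS] := leP S `|x|; first by rewrite kS// normr0 mulr0 if_same.
by move: xS; rewrite ltr_norml => /andP[/ltW -> /ltW ->]; rewrite /= mul1r.
Qed.

Definition pt (c d : R) (N i : nat) : R := c + i%:R * ((d - c) / N%:R).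

Lemma pt0 (c d : R) N : pt c d N 0 = c.
Proof. by rewrite /pt mul0r addr0. Qed.

Lemma ptN (c d : R) N : (0 < N)%N -> pt c d N N = d.
Proof.
by move=> N0; rewrite /pt mulrC divfK ?pnatr_eq0 ?lt0n_neq0// addrC subrK.
Qed.

Lemma ptS (c d : R) N i : pt c d N i.+1 - pt c d N i = (d - c) / N%:R.
Proof. by rewrite /pt -natr1; ring. Qed.

Lemma mesh_ge0 (c d : R) N : c <= d -> 0 <= (d - c) / N%:R.
Proof. by move=> cd; rewrite divr_ge0// subr_ge0. Qed.

Lemma pt_le (c d : R) N i j : c <= d -> (i <= j)%N -> pt c d N i <= pt c d N j.
Proof.
by move=> cd ij; rewrite lerD2l ler_wpM2r ?mesh_ge0// ler_nat.
Qed.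

Lemma pt_ge (c d : R) N i : c <= d -> c <= pt c d N i.
Proof. by move=> cd; rewrite -{1}(pt0 c d N) pt_le. Qed.

Lemma pt_le_end (c d : R) N i : c <= d -> (0 < N)%N -> (i <= N)%N -> pt c d N i <= d.
Proof. by move=> cd N0 iN; rewrite -{2}(ptN c d N0) pt_le. Qed.

Lemma Rintegral_pt (c d : R) N k : c <= d -> (0 < N)%N -> itg `[c, d]%classic k ->
  \int[mu]_(t in `[c, d]) k t =
  \sum_(i < N) \int[mu]_(t in `[pt c d N i, pt c d N i.+1]) k t.
Proof.
move=> cd N0 ki; rewrite -(@Rintegral_partition _ (pt c d N) k N) ?pt0 ?ptN//.
by move=> i; exact: pt_le.
Qed.

Lemma mesh_small (c d e : R) : c <= d -> 0 < e ->
  exists N0 : nat, forall N, (N0 <= N)%N -> (0 < N)%N -> (d - c) / N%:R < e.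
Proof.
move=> cd e0; exists (Num.truncn ((d - c) / e)).+1 => N + N0.
rewrite -(ler_nat R) => NN0; rewrite ltr_pdivrMr ?ltr0n// mulrC -ltr_pdivrMr//.
by rewrite (lt_le_trans (truncnS_gt _)).
Qed.

End absolutely_continuous_pairs.

Section riemann_sums.
Context {R : realType}.
Notation mu := (@lebesgue_measure R).
Implicit Types (w dw k : R -> R) (b : R -> R -> R).

(* A family of increments that is small on short sets of cells grows at most
   linearly: cut the family into blocks of total length just below [delta]. *)
Lemma short_sums_linear (D : nat -> R) (P : pred nat) (h eta delta : R) :
  0 < h -> h < delta / 2 -> 0 <= eta ->
  (forall s : seq nat, uniq s -> all P s -> (size s)%:R * h < delta ->
     \sum_(i <- s) D i <= eta) ->
  forall s : seq nat, uniq s -> all P s ->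
    \sum_(i <- s) D i <= eta + 2 * eta / delta * (h * (size s)%:R).
Proof.
move=> h0 hd eta0 HD s.
have delta0 : 0 < delta by move: (lt_trans h0 hd); rewrite pmulr_lgt0.
(* A block of k cells has length between delta / 2 and delta: it costs at most eta and uses up at
   least delta / 2, hence the slope 2 eta / delta. The additive eta pays for the last block. *)
pose k := (Num.truncn (delta / (2 * h))).+1.
have kl : delta / 2 <= k%:R * h.
  rewrite -ler_pdivrMr// -mulrA -invfM.
  by rewrite ltW// /k truncnS_gt.
have ku : k%:R * h < delta.
  have : (Num.truncn (delta / (2 * h)))%:R * h <= delta / 2.
    rewrite -ler_pdivlMr// -mulrA -invfM truncn_le//.
    by rewrite divr_ge0 ?mulr_ge0// ltW.
  rewrite /k; set n := Num.truncn _ => htr.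
  by rewrite -natr1 mulrDl mul1r [ltRHS]splitr ler_ltD.
have [n] := ubnP (size s); elim: n s => // n IHn s /ltnSE sn us sP.
have c0 : 0 <= 2 * eta / delta by rewrite divr_ge0 ?mulr_ge0// ltW.
have [sk|ks] := leqP (size s) k.
  rewrite (@le_trans _ _ eta)//; last by rewrite lerDl mulr_ge0// mulr_ge0// ltW.
  apply: HD => //; apply: le_lt_trans ku.
  by rewrite ler_pM2r// ler_nat.
rewrite -(cat_take_drop k s) big_cat/= cat_take_drop.
have usk : uniq (take k s) by exact: take_uniq.
have Pk : all P (take k s) /\ all P (drop k s).
  by apply/andP; rewrite -all_cat cat_take_drop.
have h1 : \sum_(i <- take k s) D i <= eta.
  apply: HD => //; first exact: Pk.1.
  by rewrite size_takel// ltnW.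
have h2 : \sum_(i <- drop k s) D i <= eta + 2 * eta / delta * (h * (size s - k)%:R).
  rewrite -size_drop; apply: IHn; [|exact: drop_uniq|exact: Pk.2].
  by rewrite size_drop; apply: leq_trans sn; rewrite ltn_subrL/= (leq_ltn_trans _ ks).
apply: (le_trans (lerD h1 h2)).
rewrite natrB 1?ltnW// addrA mulrBr mulrBr.
have : eta <= 2 * eta / delta * (h * k%:R).
  rewrite [h * _]mulrC; apply: le_trans (ler_wpM2l c0 kl).
  by rewrite (_ : _ * (delta / 2) = eta)//; field; rewrite gt_eqF.
lra.
Qed.

Lemma Rintegral_indic_seg_le (A B p q : R) :
  \int[mu]_(t in `[A, B]) \1_(`[p, q] `|` `[q, p]) t <= `|p - q|.
Proof.
wlog pq : p q / p <= q.
  move=> H; have [/H//|/ltW/H] := leP p q.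
  by rewrite distrC setUC.
have -> : (`[p, q] `|` `[q, p])%classic = `[p, q]%classic.
  apply/setUidPl => x /=; rewrite !in_itv/= => /andP[qx xp].
  by rewrite (le_trans pq qx) (le_trans xp pq).
rewrite distrC ger0_norm ?subr_ge0// /Rintegral integral_indic//.
rewrite -lee_fin fineK.
  apply: (@le_trans _ _ (mu `[p, q])); first by rewrite le_measure// inE//; exact: measurableI.
  rewrite lebesgue_measure_itv/= lte_fin.
  by case: ifPn => // _; rewrite lee_fin subr_ge0.
rewrite ge0_fin_numE// (le_lt_trans _ (lty_mu_itv p q))// le_measure// inE//.
exact: measurableI.
Qed.

Lemma continuous_partial1 b x : continuous (fun p : R * R => b p.1 p.2) ->
  continuous (b x).
Proof.
move=> cb s; apply: (@continuous2_cvg _ _ _ _ _ _ (fun=> x) id b).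
- exact: (cb (x, s)).
- exact: cvg_cst.
- exact: cvg_id.
Qed.

Lemma continuous_along b w : continuous (fun p : R * R => b p.1 p.2) ->
  continuous w -> continuous (fun x => b x (w x)).
Proof.
move=> cb cw x; apply: (@continuous2_cvg _ _ _ _ _ _ id w b).
- exact: (cb (x, w x)).
- exact: cvg_id.
- exact: cw.
Qed.

Lemma acpair_dist_le (c d x y : R) w dw : acpair c d w dw -> c <= x -> x <= y -> y <= d ->
  `|w y - w x| <= \int[mu]_(t in `[x, y]) `|dw t|.
Proof.
move=> [_ iw wE] cx xy yd; rewrite wE//; apply: le_normr_Rintegral => //.
exact: itg_subitv iw.
Qed.

Lemma itg_along b (c d : R) w dw : continuous (fun p : R * R => b p.1 p.2) ->
  acpair c d w dw -> itg `[c, d]%classic (fun x => b x (w x) * dw x).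
Proof.
move=> cb [cw iw _].
have cbw := continuous_along cb cw.
have [M _ HM] := compact_continuous_bounded (@segment_compact R c d) cbw.
apply: (@itgM _ _ _ _ M) => //.
by apply: measurable_funTS; exact: continuous_measurable_fun.
Qed.

(* No chain rule is needed: on a short cell, [b] is almost constant along [w],
   and the error is controlled by the total variation of the fixed [w]. *)
Lemma riemann_sum_chain_rule b (c d T : R) w dw : c <= d ->
  continuous (fun p : R * R => b p.1 p.2) -> acpair c d w dw ->
  (forall x, c <= x <= d -> T <= w x) -> forall e, 0 < e ->
  exists N0 : nat, forall N, (N0 <= N)%N -> (0 < N)%N ->
   `|\sum_(i < N) (prim (b (pt c d N i)) T (w (pt c d N i.+1)) -
                   prim (b (pt c d N i)) T (w (pt c d N i))) -
     \int[mu]_(x in `[c, d]) (b x (w x) * dw x)| <=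
   2 * e * \int[mu]_(x in `[c, d]) `|dw x|.
Proof.
move=> cd cb acw Tw e e0; have [cw iw wE] := acw.
have [W _ HW] := compact_continuous_bounded (@segment_compact R c d) cw.
pose K := (`[c, d] `*` `[- W, W])%classic : set (R * R).
have cK : compact K by apply: compact_setX; exact: segment_compact.
have [d1 d10 Hd1] := compact_unif_continuous cK cb e0.
(* A mesh below d2 moves w by less than d1 on a cell, and a mesh below d1 moves x by less than d1;
   then b varies by less than e along the graph of w. *)
have [d2 d20 Hd2] := compact_unif_continuous (@segment_compact R c d) cw d10.
have d120 : 0 < Num.min d1 d2 by rewrite lt_min d10.
have [N0 HN0] := mesh_small cd d120.
exists N0 => N NN0 N0'; have := HN0 N NN0 N0'.
rewrite lt_min => /andP[hd1 hd2].
have ptcd i : (i < N)%N -> [/\ c <= pt c d N i, pt c d N i <= pt c d N i.+1,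
    pt c d N i.+1 <= d & pt c d N i <= d].
  move=> iN; rewrite pt_ge// pt_le// !pt_le_end//; exact: ltnW.
have wK x : c <= x <= d -> K (x, w x).
  move=> xcd; split; first by rewrite /= in_itv.
  by rewrite /= in_itv/= -ler_norml HW//= in_itv.
have h_close i x : (i < N)%N -> pt c d N i <= x <= pt c d N i.+1 ->
    ball (pt c d N i) d1 x /\ `|w (pt c d N i) - w x| < d1.
  move=> iN /andP[ix xi].
  have xh : `|pt c d N i - x| <= (d - c) / N%:R.
    by rewrite distrC ger0_norm ?subr_ge0// -(ptS c d N i) lerD2r.
  split; first by rewrite /ball/=; exact: le_lt_trans hd1.
  have [ci _ _ id] := ptcd _ iN.
  apply: Hd2; first by rewrite /= in_itv/= ci id.
  by rewrite /ball/=; exact: le_lt_trans hd2.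
have ibw := itg_along cb acw.
rewrite (Rintegral_pt cd N0' ibw) (Rintegral_pt cd N0' (itg_norm iw)).
rewrite -sumrB; apply: (le_trans (ler_norm_sum _ _ _)).
rewrite mulr_sumr; apply: ler_sum => -[i iN] _ /=.
have [ci ii1 id ii] := ptcd _ iN.
set x0 := pt c d N i; set x1 := pt c d N i.+1.
have iw' : itg `[x0, x1]%classic dw by exact: itg_subitv iw.
(* Both the increment of the primitive and the integral are compared with b frozen at (x0, w x0)
   times the increment of w, hence the factor 2. *)
have h1 : `|prim (b x0) T (w x1) - prim (b x0) T (w x0) - b x0 (w x0) * (w x1 - w x0)|
    <= e * \int[mu]_(t in `[x0, x1]) `|dw t|.
  apply: (le_trans (_ : _ <= e * `|w x1 - w x0|)).
    apply: prim_affine.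
    - exact: continuous_partial1.
    - by apply: Tw; rewrite ci ii.
    - by apply: Tw; rewrite id (le_trans ci).
    move=> t tw; rewrite distrC ltW//.
    apply: (Hd1 (x0, w x0) (x0, t)); first by apply: wK; rewrite ci ii.
    split => /=; first exact: ballxx.
    have [_] : ball x0 d1 x1 /\ `|w x0 - w x1| < d1.
      by apply: h_close => //; rewrite lexx ii1.
    rewrite /ball/=; apply: le_lt_trans.
    move: tw => /orP[]/andP[t1 t2].
      by rewrite distrC ger0_norm ?subr_ge0// distrC ger0_norm ?lerD2r// subr_ge0 (le_trans t1).
    by rewrite !ger0_norm ?subr_ge0 ?lerD2l ?lerN2// (le_trans t1).
  by rewrite ler_wpM2l ?(ltW e0)//; exact: acpair_dist_le acw ci ii1 id.
have h2 : `|\int[mu]_(x in `[x0, x1]) (b x (w x) * dw x) - b x0 (w x0) * (w x1 - w x0)|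
    <= e * \int[mu]_(t in `[x0, x1]) `|dw t|.
  rewrite wE// -RintegralZl// -RintegralZl//; last exact: itg_norm.
  apply: le_dist_Rintegral => //.
  - exact: itg_subitv ibw.
  - exact: itgZ.
  - by apply: itgZ => //; exact: itg_norm.
  move=> x /=; rewrite in_itv/= => x01.
  rewrite -mulrBl normrM ler_wpM2r// distrC ltW//.
  have [bx wx] := h_close _ _ iN x01.
  by apply: (Hd1 (x0, w x0) (x, w x)) => //; apply: wK; rewrite ci ii.
have tri (X Y Z v : R) : `|X - Y| <= v -> `|Z - Y| <= v -> `|X - Z| <= 2 * v.
  move=> XY ZY; rewrite (_ : X - Z = (X - Y) - (Z - Y)); last by ring.
  by rewrite (le_trans (ler_normB _ _))// mulr_natl mulr2n lerD.
by rewrite -mulrA; exact: tri h1 h2.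
Qed.

(** Sampling at right endpoints matches the points x_i+1 at which summation by parts leaves w1 and
    w2. *)
Lemma riemann_sum_le (c d e : R) k : c <= d -> continuous k -> 0 < e ->
  exists N0 : nat, forall N, (N0 <= N)%N -> (0 < N)%N ->
   \sum_(i < N) ((d - c) / N%:R * k (pt c d N i.+1)) <=
   \int[mu]_(x in `[c, d]) k x + e * (d - c).
Proof.
move=> cd ck e0.
have [d1 d10 Hd1] := compact_unif_continuous (@segment_compact R c d) ck e0.
have [N0 HN0] := @mesh_small _ c d d1 cd d10.
exists N0 => N NN0 N0'; have hd1 := HN0 N NN0 N0'.
rewrite (Rintegral_pt cd N0' (itg_continuous c d ck)).
rewrite [e * _](_ : _ = \sum_(i < N) (e * ((d - c) / N%:R))); last first.
  by rewrite sumr_const card_ord -mulrnAr -[_ *+ N]mulr_natr divfK// pnatr_eq0 -lt0n.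
rewrite -big_split/=; apply: ler_sum => -[i iN] _ /=.
have ii1 : pt c d N i <= pt c d N i.+1 by exact: pt_le.
rewrite -lerBlDr -(ptS c d N i) [_ * k _]mulrC -mulrBl -Rintegral_itv_cst//.
apply: le_Rintegral => //; [exact: itg_cst|exact: itg_continuous|].
move=> x /=; rewrite in_itv/= => /andP[ix xi].
rewrite lerBlDr -lerBlDl (le_trans (ler_norm _))// ltW//.
have cx : c <= x by rewrite (le_trans _ ix)// pt_ge.
apply: Hd1; first by rewrite /= in_itv/= pt_ge//= pt_le_end.
rewrite /ball/= ger0_norm ?subr_ge0//; apply: le_lt_trans hd1.
by rewrite -(ptS c d N i) lerD2l lerN2.
Qed.

End riemann_sums.

(** * Continuity in L^1 of the integral of b(x, w) w' *)

Section chain_rule_continuity.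
Context {R : realType}.
Notation mu := (@lebesgue_measure R).
Implicit Types (w dw k : R -> R) (b : R -> R -> R).

Lemma ler_add_eps (x y Z : R) : 0 <= Z -> (forall e, 0 < e -> x <= y + e * Z) -> x <= y.
Proof.
move=> Z0 H; apply/ler_addgt0Pr => e e0.
have Z1 : 0 < Z + 1 by rewrite ltr_wpDl.
apply: (le_trans (H (e / (Z + 1)) _)); first by rewrite divr_gt0.
by rewrite lerD2l -mulrA ler_piMr ?(ltW e0)// mulrC ler_pdivrMr// mul1r lerDl.
Qed.

Lemma primBfun (k1 k2 : R -> R) (T s : R) : continuous k1 -> continuous k2 ->
  prim (fun t => k1 t - k2 t) T s = prim k1 T s - prim k2 T s.
Proof. by move=> c1 c2; rewrite /prim RintegralB//; exact: itg_continuous. Qed.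

Lemma leq_sum4 (a b c d : nat) : [/\ (a <= (a + b + c + d).+1)%N,
  (b <= (a + b + c + d).+1)%N, (c <= (a + b + c + d).+1)%N &
  (d <= (a + b + c + d).+1)%N].
Proof. by split; lia. Qed.

(** Absolute continuity in x, uniform in t, tested on subfamilies [s] of the cells of equal grids,
    the form that Riemann sums consume: the length of a subfamily is its size times the mesh. *)
Definition uniform_ac (c d : R) b : Prop :=
  forall eta, 0 < eta -> exists2 delta : R, 0 < delta &
  forall (N : nat) (t : R) (s : seq nat), (0 < N)%N -> uniq s ->
    all (fun i => i < N)%N s -> (size s)%:R * ((d - c) / N%:R) < delta ->
    \sum_(i <- s) `|b (pt c d N i.+1) t - b (pt c d N i) t| <= eta.

(* Write B(x, .) for a primitive of b(x, .). Summation by parts replaces the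
   increments of w1 and w2 by the differences
   [B(x_i, w1) - B(x_i, w2)] - [B(x_i+1, w1) - B(x_i+1, w2)] at x_i+1, that is by
   integrals over t between w1 and w2 of increments of b(., t); the derivatives
   of w1 and w2 have disappeared. For each t the cells that contribute have a
   total length L(t) whose integral is a Riemann sum of |w1 - w2|. *)
Lemma sum_by_parts_bound b (c d S T eta delta : R) N w1 w2 : c < d -> 0 <= S ->
  continuous (fun p : R * R => b p.1 p.2) ->
  (forall t, b c t = 0) -> (forall t, b d t = 0) ->
  (forall x t, S <= `|t| -> b x t = 0) ->
  0 <= eta -> (0 < N)%N -> (d - c) / N%:R < delta / 2 ->
  (forall t (s : seq nat), uniq s ->
    all (fun i => i < N)%N s -> (size s)%:R * ((d - c) / N%:R) < delta ->
    \sum_(i <- s) `|b (pt c d N i.+1) t - b (pt c d N i) t| <= eta) ->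
  (forall x, c <= x <= d -> T <= w1 x) -> (forall x, c <= x <= d -> T <= w2 x) ->
  `|\sum_(i < N) (prim (b (pt c d N i)) T (w1 (pt c d N i.+1)) -
                   prim (b (pt c d N i)) T (w1 (pt c d N i))) -
    \sum_(i < N) (prim (b (pt c d N i)) T (w2 (pt c d N i.+1)) -
                   prim (b (pt c d N i)) T (w2 (pt c d N i)))| <=
  2 * S * eta + 2 * eta / delta *
    \sum_(i < N) ((d - c) / N%:R * `|w1 (pt c d N i.+1) - w2 (pt c d N i.+1)|).
Proof.
move=> cd S0 cb bc bd bS eta0 N0 hd Heta Tw1 Tw2.
have cdW := ltW cd.
set h := (d - c) / N%:R.
have h0 : 0 < h by rewrite divr_gt0 ?subr_gt0// ltr0n.
have delta0 : 0 < delta by move: (lt_trans h0 hd); rewrite pmulr_lgt0.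
pose x := pt c d N.
pose P i := prim (b (x i)) T.
pose E i := P i (w1 (x i)) - P i (w2 (x i)).
pose D i t := b (x i) t - b (x i.+1) t.
have cbx y : continuous (b y) by exact: continuous_partial1.
have cD i : continuous (D i) by move=> t; apply: continuousB; exact: cbx.
have xcd i : (i <= N)%N -> c <= x i <= d.
  by move=> iN; rewrite pt_ge// pt_le_end.
have prim0 k (u : R) : (forall t, k t = 0) -> prim k T u = 0.
  move=> k0; rewrite /prim (@eq_Rintegral _ _ _ mu _ (fun=> 0)); last by move=> ? _.
  by rewrite /Rintegral integral0.
have -> : \sum_(i < N) (P i (w1 (x i.+1)) - P i (w1 (x i))) -
          \sum_(i < N) (P i (w2 (x i.+1)) - P i (w2 (x i))) =
    \sum_(i < N) (prim (D i) T (w1 (x i.+1)) - prim (D i) T (w2 (x i.+1))).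
  (* Summation by parts: [E] vanishes at both ends because b does at c and d, so the telescoping sum
     may be subtracted freely. *)
  have /esym tel : \sum_(i < N) (E i.+1 - E i) = 0.
    rewrite -(big_mkord xpredT (fun i => E i.+1 - E i)) telescope_sumr//.
    by rewrite /E /P /x pt0 ptN// !prim0// !subrr.
  rewrite -sumrB -[LHS]subr0 [X in _ - X]tel -sumrB; apply: eq_bigr => i _.
  by rewrite !primBfun// /E /P; ring.
pose Q i : set (measurableTypeR R) :=
  (`[w2 (x i.+1), w1 (x i.+1)] `|` `[w1 (x i.+1), w2 (x i.+1)])%classic.
have mQ i : measurable (Q i) by exact: measurableU.
have iQ i : itg `[- S, S]%classic (\1_(Q i) : R -> R).
  apply: (@itg_bounded _ _ _ 1) => //.
  by move=> t _; rewrite indicE ger0_norm//; case: (_ \in _).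
have iQD i : itg `[- S, S]%classic (fun t => \1_(Q i) t * `|D i t|).
  have cDN : continuous (fun t => `|D i t|).
    by move=> t; apply: continuous_comp; [exact: cD|exact: norm_continuous].
  apply: (@itgM _ _ _ _ 1 _ _ _ (itg_continuous (- S) S cDN)) => //.
  by move=> t _; rewrite indicE ger0_norm//; case: (_ \in _).
apply: (le_trans (ler_norm_sum _ _ _)).
apply: (@le_trans _ _ (\sum_(i < N) \int[mu]_(t in `[- S, S]) (\1_(Q i) t * `|D i t|))).
  apply: ler_sum => -[i iN] _ /=; apply: prim_dist_le => //.
  - by apply: Tw2; exact: xcd.
  - by apply: Tw1; exact: xcd.
  - by move=> t St; rewrite /D !bS// subrr.
rewrite -Rintegral_sum//.
apply: (@le_trans _ _ (\int[mu]_(t in `[- S, S])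
   (eta + 2 * eta / delta * \sum_(i < N) (h * \1_(Q i) t)))).
  apply: le_Rintegral => //.
  - exact: itg_sum.
  - apply: itgD => //; first exact: itg_cst.
    by apply: itgZ => //; apply: itg_sum => // i; exact: itgZ.
  move=> t _.
  (* The cells that contribute at t, of total length h times [size s]; [short_sums_linear] bounds
     their increments. *)
  pose s := [seq i <- index_iota 0 N | t \in Q i].
  have -> : \sum_(i < N) (\1_(Q i) t * `|D i t|) = \sum_(i <- s) `|D i t|.
    rewrite -(big_mkord xpredT (fun i => \1_(Q i) t * `|D i t|)) big_filter.
    rewrite [RHS]big_mkcond/=; apply: eq_bigr => i _; rewrite indicE.
    by case: (t \in Q i); rewrite /= ?mul1r ?mul0r.
  have -> : \sum_(i < N) (h * \1_(Q i) t) = h * (size s)%:R.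
    rewrite -(big_mkord xpredT (fun i => h * \1_(Q i) t)) -mulr_sumr; congr (_ * _).
    rewrite size_filter -sum1_count natr_sum [RHS]big_mkcond/=.
    by apply: eq_bigr => i _; rewrite indicE; case: (t \in Q i).
  apply: (@short_sums_linear _ (fun i => `|D i t|) (fun i => i < N)%N) => //.
  - move=> s' us' as' sd; apply: le_trans (Heta t s' us' as' sd).
    by apply: ler_sum => i _; rewrite /D distrC.
  - by rewrite filter_uniq// iota_uniq.
  - by apply/allP => i; rewrite mem_filter mem_index_iota => /andP[_ /andP[]].
have iS : itg `[- S, S]%classic (fun t => \sum_(i < N) (h * \1_(Q i) t)).
  by apply: itg_sum => // i; exact: itgZ.
rewrite RintegralD//; last 2 first.
- exact: itg_cst.
- exact: itgZ.
have NSS : - S <= S by lra.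
rewrite Rintegral_itv_cst// RintegralZl//.
apply: lerD; first by lra.
rewrite ler_wpM2l//; first by rewrite divr_ge0 ?mulr_ge0// ltW.
rewrite Rintegral_sum//; last by move=> i; exact: itgZ.
apply: ler_sum => i _; rewrite RintegralZl//; last exact: iQ.
rewrite ler_wpM2l ?(ltW h0)//.
by rewrite distrC; exact: Rintegral_indic_seg_le.
Qed.

(** For given w1 and w2 the mesh tends to 0. The error in the chain rule involves their total
    variations, but only multiplied by e, and disappears; what survives is the bound by parts, whose
    constants come from b and eta alone. This is why C precedes the functions. *)
Lemma chain_rule_integral_continuity b (c d S : R) : c < d -> 0 <= S ->
  continuous (fun p : R * R => b p.1 p.2) ->
  (forall t, b c t = 0) -> (forall t, b d t = 0) ->
  (forall x t, S <= `|t| -> b x t = 0) -> uniform_ac c d b ->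
  forall eta, 0 < eta -> exists2 C : R, 0 <= C & forall w1 dw1 w2 dw2,
    acpair c d w1 dw1 -> acpair c d w2 dw2 ->
    `|\int[mu]_(x in `[c, d]) (b x (w1 x) * dw1 x) -
      \int[mu]_(x in `[c, d]) (b x (w2 x) * dw2 x)| <=
    eta + C * \int[mu]_(x in `[c, d]) `|w1 x - w2 x|.
Proof.
move=> cd S0 cb bc bd bS acb eta eta0.
have S1 : 0 < 2 * S + 1 by rewrite ltr_wpDl// mulr_ge0.
(* Chosen so that 2 S eta' <= eta; adding 1 covers S = 0. *)
pose eta' := eta / (2 * S + 1).
have eta'0 : 0 < eta' by rewrite divr_gt0.
have [delta delta0 Hd] := acb _ eta'0.
pose C := 2 * eta' / delta.
have C0 : 0 <= C by rewrite divr_ge0 ?(ltW delta0)// mulr_ge0// (ltW eta'0).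
exists C => // w1 dw1 w2 dw2 ac1 ac2.
have [cw1 iw1 _] := ac1; have [cw2 iw2 _] := ac2.
have [W1 W10 HW1] := compact_continuous_bounded (@segment_compact R c d) cw1.
have [W2 W20 HW2] := compact_continuous_bounded (@segment_compact R c d) cw2.
(* A common base point below both ranges, as [prim] requires. *)
pose T := - (W1 + W2).
have Tw1 x : c <= x <= d -> T <= w1 x.
  move=> xcd; have := HW1 x; rewrite /= in_itv/= => /(_ xcd).
  rewrite ler_norml => /andP[+ _]; apply: le_trans.
  by rewrite /T opprD gerDl oppr_le0.
have Tw2 x : c <= x <= d -> T <= w2 x.
  move=> xcd; have := HW2 x; rewrite /= in_itv/= => /(_ xcd).
  rewrite ler_norml => /andP[+ _]; apply: le_trans.
  by rewrite /T opprD gerDr oppr_le0.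
have cdW := ltW cd.
have cN : continuous (fun x => `|w1 x - w2 x|).
  by move=> x; apply: cvg_norm; apply: cvgB; [exact: cw1|exact: cw2].
set I1 := \int[mu]_(x in `[c, d]) (b x (w1 x) * dw1 x).
set I2 := \int[mu]_(x in `[c, d]) (b x (w2 x) * dw2 x).
set L := \int[mu]_(x in `[c, d]) `|w1 x - w2 x|.
pose V1 := \int[mu]_(x in `[c, d]) `|dw1 x|.
pose V2 := \int[mu]_(x in `[c, d]) `|dw2 x|.
have V10 : 0 <= V1 by apply: Rintegral_ge0.
have V20 : 0 <= V2 by apply: Rintegral_ge0.
apply: (@ler_add_eps _ _ (2 * V1 + 2 * V2 + C * (d - c))).
  by apply: addr_ge0; [apply: addr_ge0|]; apply: mulr_ge0; rewrite ?subr_ge0.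
move=> e e0.
have [N1 HN1] := riemann_sum_chain_rule cdW cb ac1 Tw1 e0.
have [N2 HN2] := riemann_sum_chain_rule cdW cb ac2 Tw2 e0.
have [N3 HN3] := riemann_sum_le cdW cN e0.
have delta20 : 0 < delta / 2 by rewrite divr_gt0.
have [N4 HN4] := mesh_small cdW delta20.
pose N := (N1 + N2 + N3 + N4).+1.
have N0 : (0 < N)%N by [].
have [/HN1 {}HN1 /HN2 {}HN2 /HN3 {}HN3 /HN4 {}HN4] := leq_sum4 N1 N2 N3 N4.
move: (HN1 N0) (HN2 N0) (HN3 N0) (HN4 N0) => {}HN1 {}HN2 {}HN3 {}HN4.
have HB := @sum_by_parts_bound b c d S T eta' delta N w1 w2 cd S0 cb bc bd bS
  (ltW eta'0) N0 HN4 (fun t s => Hd N t s N0) Tw1 Tw2.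
move: HN1 HN2 HB; rewrite -/I1 -/I2 -/V1 -/V2 -/C.
set S1' := \sum_(i < N) _; set S2' := \sum_(i < N) _.
move: HN3; set S3' := \sum_(i < N) _ => HN3 HN1 HN2 HB.
have eta'S : 2 * S * eta' <= eta.
  by rewrite /eta' mulrA ler_pdivrMr// mulrC ler_pM2l// lerDl.
have {}HB : `|S1' - S2'| <= eta + C * (L + e * (d - c)).
  by rewrite (le_trans HB)// lerD// ler_wpM2l.
clearbody I1 I2 L V1 V2 S1' S2' S3' C; clear - HN1 HN2 HB.
rewrite (_ : I1 - I2 = (S1' - S2') - (S1' - I1) + (S2' - I2)); last by ring.
apply: (le_trans (ler_normD _ _)).
apply: (le_trans (lerD (ler_normB _ _) HN2)).
apply: (le_trans (lerD (lerD HB HN1) (lexx _))).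
lra.
Qed.

End chain_rule_continuity.

(** * Affine minorants and cut-off functions *)

Section convex_minorant.
Context {R : realType}.

(* The chord of slope [(phi (xi + r) - phi xi) / r] minorizes a convex function
   outside [xi, xi + r], and up to the oscillation inside. *)
Lemma convex_chord_le (phi : R -> R) (xi r om z : R) : 0 < r ->
  (forall x y t, 0 <= t <= 1 ->
    phi (t * x + (1 - t) * y) <= t * phi x + (1 - t) * phi y) ->
  (forall y, xi <= y <= xi + r ->
    `|phi xi - phi y| <= om /\ `|phi (xi + r) - phi y| <= om) ->
  phi xi + (phi (xi + r) - phi xi) / r * (z - xi) - om <= phi z.
Proof.
move=> r0 cphi osc.
have om0 : 0 <= om.
  have [|+ _] := osc xi; first by rewrite lexx lerDl ltW.
  by rewrite subrr normr0.
have rn0 : r != 0 by rewrite gt_eqF.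
set q := _ / r.
have qr : q * r = phi (xi + r) - phi xi by rewrite /q divfK.
have [zxi|xiz] := ltP z xi.
  have D0 : 0 < xi + r - z by lra.
  (* The weight of z when xi is written as a convex combination of z and xi + r. To the right of the
     chord the same is done with xi + r between xi and z. *)
  pose t := r / (xi + r - z).
  have tD : t * (xi + r - z) = r by rewrite /t divfK// gt_eqF.
  have t0 : 0 < t by rewrite divr_gt0.
  have t1 : t <= 1 by rewrite ler_pdivrMr// mul1r; lra.
  have := cphi z (xi + r) t; rewrite (ltW t0) t1 => /(_ isT).
  have -> : t * z + (1 - t) * (xi + r) = xi by lra.
  have ht : t * (z - xi) = t * r - r by lra.
  clearbody t q; move=> H; suff : phi xi + q * (z - xi) <= phi z by lra.
  rewrite -(ler_pM2l t0) mulrDr mulrCA ht.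
  have -> : q * (t * r - r) = t * (q * r) - q * r by ring.
  rewrite qr; lra.
have [zr|rz] := leP z (xi + r).
  have [h1 h2] := osc z ltac:(by rewrite xiz).
  (* Inside, the chord takes an average of the two end values, both within [om] of phi z. *)
  pose t := (z - xi) / r.
  have tr : t * r = z - xi by rewrite /t divfK.
  have t0 : 0 <= t by apply: divr_ge0; [rewrite subr_ge0|exact: ltW].
  have t1 : t <= 1 by rewrite ler_pdivrMr// mul1r; lra.
  have -> : q * (z - xi) = t * (phi (xi + r) - phi xi) by rewrite -qr -tr; ring.
  move: h1 h2; rewrite !ler_norml => /andP[_ h1] /andP[_ h2]; nra.
have D0 : 0 < z - xi by lra.
pose t := r / (z - xi).
have tD : t * (z - xi) = r by rewrite /t divfK// gt_eqF.
have t0 : 0 < t by rewrite divr_gt0.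
have t1 : t <= 1 by rewrite ler_pdivrMr// mul1r; lra.
have := cphi z xi t; rewrite (ltW t0) t1 => /(_ isT).
have -> : t * z + (1 - t) * xi = xi + r by lra.
clearbody t q; move=> H; suff : phi xi + q * (z - xi) <= phi z by lra.
rewrite -(ler_pM2l t0) mulrDr mulrCA tD qr; lra.
Qed.

End convex_minorant.

(** * Lipschitz cut-off functions *)

Section cutoffs.
Context {R : realType}.
Notation mu := (@lebesgue_measure R).

Lemma dist_min_le (u v u' v' e : R) : `|u - u'| <= e -> `|v - v'| <= e ->
  `|Num.min u v - Num.min u' v'| <= e.
Proof.
by rewrite !ler_norml => /andP[? ?] /andP[? ?]; case: (leP u v); case: (leP u' v') => *;
  apply/andP; split; lra.
Qed.

Lemma dist_max_le (u v u' v' e : R) : `|u - u'| <= e -> `|v - v'| <= e ->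
  `|Num.max u v - Num.max u' v'| <= e.
Proof.
by rewrite !ler_norml => /andP[? ?] /andP[? ?]; case: (leP u v); case: (leP u' v') => *;
  apply/andP; split; lra.
Qed.

Lemma lipschitz_continuous (k : R -> R) (K : R) :
  (forall x y, `|k x - k y| <= K * `|x - y|) -> continuous k.
Proof.
move=> Hk x; apply/cvgrPdist_le => e e0.
near=> y.
have K0 : 0 < `|K| + 1 by rewrite ltr_wpDl.
rewrite (le_trans (Hk x y))// (@le_trans _ _ ((`|K| + 1) * `|x - y|))//.
  by rewrite ler_wpM2r// (le_trans (ler_norm K))// lerDl.
rewrite mulrC -ler_pdivlMr//.
near: y; apply: cvgr_dist_le; first exact: cvg_id.
by rewrite divr_gt0// ltr_wpDl.
Unshelve. all: by end_near. Qed.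

Definition clip (y : R) : R := Num.max 0 (Num.min 1 y).

Lemma clip_ge0 y : 0 <= clip y. Proof. by rewrite /clip le_max lexx. Qed.

Lemma clip_le1 y : clip y <= 1.
Proof. by rewrite /clip ge_max ler01 ge_min lexx. Qed.

Lemma clip_eq0 y : y <= 0 -> clip y = 0.
Proof. by move=> y0; apply/max_idPl; rewrite ge_min y0 orbT. Qed.

Lemma clip_eq1 y : 1 <= y -> clip y = 1.
Proof. by move=> y1; rewrite /clip (min_idPl y1); apply/max_idPr. Qed.

Lemma clip_dist_le x y e : `|x - y| <= e -> `|clip x - clip y| <= e.
Proof.
move=> xy; have e0 : 0 <= e by exact: le_trans xy.
by apply: dist_max_le; [|apply: dist_min_le]; rewrite ?subrr ?normr0.
Qed.

(* [plateau] vanishes at the ends of [c, d], so that no convergence of the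
   functions at the endpoints is ever needed. *)
Definition plateau (c d K x : R) : R := clip (Num.min (K * (x - c)) (K * (d - x))).

Definition taper (S s : R) : R := clip (S - `|s|).

Lemma plateau_lip (c d K x y : R) : 0 <= K ->
  `|plateau c d K x - plateau c d K y| <= K * `|x - y|.
Proof.
move=> K0; apply: clip_dist_le; apply: dist_min_le; rewrite -mulrBr normrM ger0_norm//.
  by rewrite (_ : x - c - (y - c) = x - y)//; ring.
by rewrite (_ : d - x - (d - y) = y - x) ?[`|y - x|]distrC//; ring.
Qed.

Lemma plateau_continuous (c d K : R) : 0 <= K -> continuous (plateau c d K).
Proof. by move=> K0; apply: (@lipschitz_continuous _ K) => x y; exact: plateau_lip. Qed.

Lemma plateau_left (c d K : R) : 0 <= K -> plateau c d K c = 0.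
Proof. by move=> K0; apply: clip_eq0; rewrite subrr mulr0 ge_min lexx. Qed.

Lemma plateau_right (c d K : R) : 0 <= K -> plateau c d K d = 0.
Proof. by move=> K0; apply: clip_eq0; rewrite subrr mulr0 ge_min lexx orbT. Qed.

Lemma taper_continuous (S : R) : continuous (taper S).
Proof.
apply: (@lipschitz_continuous _ 1) => x y; apply: clip_dist_le.
rewrite mul1r (_ : S - _ - _ = - (`|x| - `|y|)); last by ring.
by rewrite normrN ler_dist_dist.
Qed.

Lemma taper_eq0 (S s : R) : S <= `|s| -> taper S s = 0.
Proof. by move=> Ss; apply: clip_eq0; rewrite subr_le0. Qed.

Lemma taper_eq1 (S s : R) : `|s| <= S - 1 -> taper S s = 1.
Proof. by move=> Ss; apply: clip_eq1; rewrite lerBrDr -lerBrDl. Qed.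

(** The plateau differs from 1 only within 1 / K of an endpoint. The two layers may overlap, so K is
    not tied to d - c. *)
Lemma plateau_integral (c d K : R) : 0 < K ->
  \int[mu]_(x in `[c, d]) (1 - plateau c d K x) <= 2 / K.
Proof.
move=> K0; have K1 : 0 < K^-1 by rewrite invr_gt0.
pose I p q : set (measurableTypeR R) := (`[p, q] `|` `[q, p])%classic.
have mI p q : measurable (I p q) by exact: measurableU.
have iI p q : itg `[c, d]%classic (\1_(I p q) : R -> R).
  apply: (@itg_bounded _ _ _ 1) => //.
  by move=> t _; rewrite indicE ger0_norm//; case: (_ \in _).
apply: (@le_trans _ _ (\int[mu]_(x in `[c, d])
   (\1_(I c (c + K^-1)) x + \1_(I d (d - K^-1)) x))).
  apply: le_Rintegral => //.
  - apply: itgB => //; first exact: itg_cst.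
    by apply: itg_continuous; apply: plateau_continuous; exact: ltW.
  - exact: itgD.
  move=> x /=; rewrite in_itv/= => /andP[cx xd].
  rewrite !indicE !in_setU !mem_setE !in_itv/= cx xd/=.
  have b0 : 0 <= plateau c d K x by exact: clip_ge0.
  have [xc|xc] := leP x (c + K^-1).
    by rewrite /= -[1%:R]/1; case: (_ || _); rewrite /= ?mulr1n ?mulr0n; lra.
  have [xd'|xd'] := leP (d - K^-1) x.
    by rewrite orbT; case: (_ || _); rewrite /= ?mulr1n ?mulr0n; lra.
  rewrite /plateau clip_eq1 ?subrr ?addr_ge0// le_min.
  rewrite -!ler_pdivrMl// mulr1; apply/andP; split; lra.
rewrite RintegralD//; [|exact: iI|exact: iI].
apply: (le_trans (lerD (Rintegral_indic_seg_le _ _ _ _) (Rintegral_indic_seg_le _ _ _ _))).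
have -> : c - (c + K^-1) = - K^-1 by ring.
have -> : d - (d - K^-1) = K^-1 by ring.
rewrite normrN gtr0_norm//; lra.
Qed.

End cutoffs.

(** * Lower bounds on compact intervals *)

Section cell_estimate.
Context {R : realType}.
Notation mu := (@lebesgue_measure R).
Implicit Types (w dw u du : R -> R) (A : R -> R -> R) (g : R -> R -> R -> R).

(** Uniform continuity gives eta when |s - s'| < [de]; otherwise 2 M <= (2 M / de) |s - s'|. A
    modulus affine in |s - s'| integrates to a bound by the L^1 distance. *)
Lemma taper_lipschitz_modulus A (c d S : R) : 0 <= S ->
  continuous (fun p : R * R => A p.1 p.2) ->
  (forall x s, S <= `|s| -> A x s = 0) ->
  forall eta, 0 < eta -> exists2 C : R, 0 <= C & forall x s s', c <= x <= d ->
    `|A x s - A x s'| <= eta + C * `|s - s'|.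
Proof.
move=> S0 cA AS eta eta0.
(* The margin 1 goes with [de] <= 1: if |s| > S + 1 and |s - s'| < [de], then |s'| >= S and both
   values vanish. *)
pose K := (`[c, d] `*` `[- (S + 1), S + 1])%classic : set (R * R).
have cK : compact K by apply: compact_setX; exact: segment_compact.
have [d1 d10 Hd1] := compact_unif_continuous cK cA eta0.
have [M M0 HM] := compact_continuous_bounded cK cA.
pose de := Num.min d1 1.
have de0 : 0 < de by rewrite lt_min d10 ltr01.
exists (2 * M / de); first by apply: divr_ge0; [rewrite mulr_ge0|exact: ltW].
have AM x s : c <= x <= d -> `|A x s| <= M.
  move=> xcd; have [Ss|sS] := leP S `|s|; first by rewrite AS// normr0.
  apply: (HM (x, s)); split; rewrite /= in_itv//= -ler_norml.
  by rewrite (le_trans (ltW sS))// lerDl.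
move=> x s s' xcd; have [ss'|ss'] := ltP `|s - s'| de.
  have : `|A x s - A x s'| <= eta.
    have [sS|sS] := leP `|s| (S + 1).
      rewrite ltW//; apply: (Hd1 (x, s) (x, s')).
        by split; rewrite /= in_itv//= -ler_norml.
      split; first exact: ballxx.
      by rewrite /ball/= (lt_le_trans ss')// /de ge_min lexx.
    have sS' : S <= `|s'|.
      have : `|s| <= `|s'| + `|s - s'|.
        by rewrite addrC -lerBlDr (le_trans _ (lerB_dist _ _)).
      have : `|s - s'| < 1 by rewrite (lt_le_trans ss')// /de ge_min lexx orbT.
      lra.
    by rewrite !AS// ?subrr ?normr0 ?(ltW eta0)//; lra.
  move=> H; rewrite (le_trans H)// lerDl mulr_ge0//.
  by apply: divr_ge0; [rewrite mulr_ge0|exact: ltW].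
apply: (@le_trans _ _ (2 * M)).
  by rewrite (le_trans (ler_normB _ _))// mulr_natl mulr2n lerD// AM.
rewrite (@le_trans _ _ (2 * M / de * `|s - s'|))//; last by rewrite lerDr ltW.
by rewrite mulrAC ler_pdivlMr// ler_wpM2l// mulr_ge0.
Qed.

Lemma continuous_section g z : continuous (fun p : R * R * R => g p.1.1 p.1.2 p.2) ->
  continuous (fun p : R * R => g p.1 p.2 z).
Proof.
move=> cg p; apply: (@continuous_comp _ _ _ (fun p : R * R => (p, z))
  (fun p : R * R * R => g p.1.1 p.1.2 p.2)); last exact: cg.
by apply: (@cvg_pair _ _ _ _ (nbhs p) (nbhs z)); [exact: cvg_id|exact: cvg_cst].
Qed.

(** (H4) on the equal grids of all subintervals of [a, b]: a single hypothesis serves every cell of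
    a partition of [a, b]. *)
Definition equi_ac (a b : R) g : Prop :=
  forall S M eta : R, 0 < eta -> exists2 delta : R, 0 < delta &
  forall c d, a <= c -> c < d -> d <= b ->
  forall (N : nat) (t z : R) (s : seq nat), `|t| <= S -> `|z| <= M ->
    (0 < N)%N -> uniq s -> all (fun i => i < N)%N s ->
    (size s)%:R * ((d - c) / N%:R) < delta ->
    \sum_(i <- s) `|g (pt c d N i.+1) t z - g (pt c d N i) t z| <= eta.

Definition slope g (xi r x s : R) : R := (g x s (xi + r) - g x s xi) / r.

Lemma slope_continuous g xi r : continuous (fun p : R * R * R => g p.1.1 p.1.2 p.2) ->
  continuous (fun p : R * R => slope g xi r p.1 p.2).
Proof.
move=> cg p; rewrite /slope; apply: cvgM; last exact: cvg_cst.
by apply: cvgB; exact: continuous_section.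
Qed.

(** Product rule for increments in x: the plateau is K-Lipschitz and at most 1, the taper is
    constant in x and at most 1, and the slope is bounded by Q where the taper is nonzero. *)
Lemma uniform_ac_slope (a b c d xi r S K : R) g :
  a <= c -> c < d -> d <= b -> 0 < r -> 0 <= K ->
  continuous (fun p : R * R * R => g p.1.1 p.1.2 p.2) -> equi_ac a b g ->
  uniform_ac c d (fun x s => plateau c d K x * taper S s * slope g xi r x s).
Proof.
move=> ac cd db r0 K0 cg eg eta eta0; have cdW := ltW cd.
pose M := `|xi| + r.
have xiM : `|xi| <= M by rewrite lerDl ltW.
have xirM : `|xi + r| <= M by rewrite (le_trans (ler_normD _ _))// (gtr0_norm r0).
(* The slope contains two values of g divided by r, each costing eta / 4; the plateau costs the
   other eta / 2 through [d2]. *)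
have eta1 : 0 < eta * r / 4 by rewrite divr_gt0// mulr_gt0.
have [d1 d10 Hd1] := eg S M _ eta1.
pose Kc := (`[c, d] `*` `[- S, S])%classic : set (R * R).
have cK : compact Kc by apply: compact_setX; exact: segment_compact.
have [Q Q0 HQ] := compact_continuous_bounded cK (@slope_continuous g xi r cg).
pose d2 := eta / (2 * (K * Q + 1)).
have KQ : 0 < 2 * (K * Q + 1) by rewrite mulr_gt0// ltr_wpDl// mulr_ge0.
have d20 : 0 < d2 by rewrite divr_gt0.
exists (Num.min d1 d2); first by rewrite lt_min d10.
move=> N t s N0 us sN; rewrite lt_min => /andP[sd1 sd2].
have [St|tS] := ltP S `|t|.
  rewrite big1_seq ?(ltW eta0)// => i _.
  by rewrite taper_eq0 ?(ltW St)// !mulr0 !mul0r subrr normr0.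
set x := pt c d N.
have xcd i : (i <= N)%N -> c <= x i <= d by move=> iN; rewrite pt_ge// pt_le_end.
set h := (d - c) / N%:R.
have h0 : 0 <= h by exact: mesh_ge0.
have st i : i \in s -> `|plateau c d K (x i.+1) * taper S t * slope g xi r (x i.+1) t -
    plateau c d K (x i) * taper S t * slope g xi r (x i) t| <=
  r^-1 * `|g (x i.+1) t (xi + r) - g (x i) t (xi + r)| +
  r^-1 * `|g (x i.+1) t xi - g (x i) t xi| + K * Q * h.
  move=> /(allP sN) iN.
  set l1 := plateau _ _ _ (x i.+1); set l0 := plateau _ _ _ (x i).
  set q1 := slope _ _ _ (x i.+1) _; set q0 := slope _ _ _ (x i) _.
  have l10 : `|l1| <= 1 by rewrite ger0_norm ?clip_ge0 ?clip_le1.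
  have tt : `|taper S t| <= 1 by rewrite ger0_norm ?clip_ge0 ?clip_le1.
  have ll : `|l1 - l0| <= K * h.
    rewrite (le_trans (plateau_lip _ _ _ _ K0))// ptS ger0_norm//.
  have qQ : `|q0| <= Q.
    apply: (HQ (x i, t)); split; rewrite /= in_itv/= -?ler_norml//.
    by apply: xcd; exact: ltnW.
  have -> : l1 * taper S t * q1 - l0 * taper S t * q0 =
    taper S t * (l1 * (q1 - q0) + (l1 - l0) * q0) by ring.
  rewrite normrM (@le_trans _ _ (1 * `|l1 * (q1 - q0) + (l1 - l0) * q0|))//.
    by rewrite ler_wpM2r.
  rewrite mul1r (le_trans (ler_normD _ _))// lerD//.
    rewrite normrM (@le_trans _ _ (1 * `|q1 - q0|))//; first by rewrite ler_wpM2r.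
    rewrite mul1r -mulrDr /q1 /q0 /slope -mulrBl normrM mulrC gtr0_norm ?invr_gt0//.
    rewrite ler_pM2l ?invr_gt0//.
    rewrite (_ : _ - _ - _ = (g (x i.+1) t (xi + r) - g (x i) t (xi + r)) -
      (g (x i.+1) t xi - g (x i) t xi)); last by ring.
    exact: ler_normB.
  by rewrite normrM mulrAC ler_pM.
apply: (@le_trans _ _ (\sum_(i <- s) (r^-1 * `|g (x i.+1) t (xi + r) - g (x i) t (xi + r)| +
  r^-1 * `|g (x i.+1) t xi - g (x i) t xi| + K * Q * h))).
  by rewrite big_seq [leRHS]big_seq; apply: ler_sum => i; exact: st.
have KQh : \sum_(i <- s) (K * Q * h) = K * Q * ((size s)%:R * h).
  by rewrite big_const_seq count_predT iter_addr_0 mulr_natl mulrnAr.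
rewrite !big_split/= KQh -!mulr_sumr.
have h1 := Hd1 c d ac cd db N t (xi + r) s tS xirM N0 us sN sd1.
have h2 := Hd1 c d ac cd db N t xi s tS xiM N0 us sN sd1.

have h3 : K * Q * ((size s)%:R * h) <= eta / 2.
  apply: (@le_trans _ _ ((K * Q + 1) * d2)).
    by apply: ler_pM; rewrite ?lerDl ?(ltW sd2)//; apply: mulr_ge0.
  have KQ1 : K * Q + 1 != 0 by rewrite gt_eqF// ltr_wpDl// mulr_ge0.
  by rewrite /d2 (_ : (K * Q + 1) * _ = eta / 2)//; field.
have h4 y : y <= eta * r / 4 -> r^-1 * y <= eta / 4.
  move=> yle; rewrite ler_pdivrMl//; lra.
move: (h4 _ h1) (h4 _ h2) h3; lra.
Qed.

(** The cut-off minorant is A(x, s) + be(x, s) z. From w to u, the integral of be(x, w) w' is moved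
    by the chain-rule continuity and that of A(x, w) by the modulus of A, each at cost eta / 2. At u
    the taper equals 1 because |u| <= S - 1. *)
Lemma cell_lower_bound (a b c d xi r S K om : R) g u du :
  a <= c -> c < d -> d <= b -> 0 < r -> 0 <= K -> 1 <= S ->
  continuous (fun p : R * R * R => g p.1.1 p.1.2 p.2) -> equi_ac a b g ->
  (forall x s z, 0 <= g x s z) ->
  (forall x s y z t, 0 <= t <= 1 ->
    g x s (t * y + (1 - t) * z) <= t * g x s y + (1 - t) * g x s z) ->
  (forall x s z, c <= x <= d -> `|s| <= S -> xi <= z <= xi + r ->
    `|g x s xi - g x s z| <= om /\ `|g x s (xi + r) - g x s z| <= om) ->
  acpair c d u du -> (forall x, c <= x <= d -> `|u x| <= S - 1) ->
  forall eta, 0 < eta -> exists2 C : R, 0 <= C & forall w dw, acpair c d w dw ->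
    itg `[c, d]%classic (fun x => g x (w x) (dw x)) ->
    itg `[c, d]%classic (fun x => plateau c d K x *
        (g x (u x) xi + slope g xi r x (u x) * (du x - xi) - om)) /\
    \int[mu]_(x in `[c, d]) (plateau c d K x *
        (g x (u x) xi + slope g xi r x (u x) * (du x - xi) - om)) -
      eta - C * \int[mu]_(x in `[c, d]) `|w x - u x| <=
    \int[mu]_(x in `[c, d]) g x (w x) (dw x).
Proof.
move=> ac cd db r0 K0 S1 cg eg g0 cvx osc acu uS eta eta0.
have cdW := ltW cd; have S0 : 0 <= S by rewrite (le_trans _ S1).
pose be x s := plateau c d K x * taper S s * slope g xi r x s.
pose A x s := plateau c d K x * taper S s * (g x s xi - slope g xi r x s * xi - om).
have cbt : continuous (fun p : R * R => plateau c d K p.1 * taper S p.2).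
  move=> p; apply: cvgM.
    by apply: (continuous_comp cvg_fst); exact: plateau_continuous.
  by apply: (continuous_comp cvg_snd); exact: taper_continuous.
have cbe : continuous (fun p : R * R => be p.1 p.2).
  by move=> p; apply: cvgM; [exact: cbt|exact: slope_continuous].
have cA : continuous (fun p : R * R => A p.1 p.2).
  move=> p; apply: cvgM; first exact: cbt.
  apply: cvgB; last exact: cvg_cst.
  apply: cvgB; first exact: continuous_section.
  by apply: cvgM; [exact: slope_continuous|exact: cvg_cst].
have beS x s : S <= `|s| -> be x s = 0.
  by move=> Ss; rewrite /be taper_eq0// mulr0 mul0r.
have AS x s : S <= `|s| -> A x s = 0.
  by move=> Ss; rewrite /A taper_eq0// mulr0 mul0r.
have bec t : be c t = 0 by rewrite /be plateau_left// !mul0r.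
have bed t : be d t = 0 by rewrite /be plateau_right// !mul0r.
have eta20 : 0 < eta / 2 by rewrite divr_gt0.
have [C1 C10 HC1] := chain_rule_integral_continuity cd S0 cbe bec bed beS
  (uniform_ac_slope xi S ac cd db r0 K0 cg eg) eta20.
have eta2d : 0 < eta / 2 / (d - c) by rewrite divr_gt0// subr_gt0.
have [C2 C20 HC2] := taper_lipschitz_modulus c d S0 cA AS eta2d.
(* Here g >= 0 enters: a cut-off factor in [0, 1] can only lower g. *)
have minor x s z : c <= x <= d -> A x s + be x s * z <= g x s z.
  move=> xcd; have [Ss|sS] := leP S `|s|; first by rewrite AS// beS// mul0r addr0.
  have -> : A x s + be x s * z = plateau c d K x * taper S s *
    (g x s xi + slope g xi r x s * (z - xi) - om) by rewrite /A /be; ring.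
  have H : g x s xi + slope g xi r x s * (z - xi) - om <= g x s z.
    apply: convex_chord_le => // [y1 y2 t t01|y yxi]; first exact: cvx.
    by apply: osc => //; exact: ltW.
  have l0 := clip_ge0 (Num.min (K * (x - c)) (K * (d - x))).
  have l1 := clip_le1 (Num.min (K * (x - c)) (K * (d - x))).
  have t0 := clip_ge0 (S - `|s|); have t1 := clip_le1 (S - `|s|).
  rewrite -/(plateau c d K x) -/(taper S s) in l0 l1 t0 t1.
  apply: (@le_trans _ _ (plateau c d K x * taper S s * g x s z)).
    by rewrite ler_wpM2l// mulr_ge0.
  by rewrite ler_piMl// mulr_ile1.
exists (C1 + C2); first exact: addr_ge0.
move=> w dw acw iw.
have [cw idw _] := acw; have [cu idu _] := acu.
have iAw := itg_continuous c d (continuous_along cA cw).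
have iAu := itg_continuous c d (continuous_along cA cu).
have ibw := itg_along cbe acw; have ibu := itg_along cbe acu.
have uE x : c <= x <= d -> A x (u x) + be x (u x) * du x = plateau c d K x *
        (g x (u x) xi + slope g xi r x (u x) * (du x - xi) - om).
  by move=> xcd; rewrite /A /be taper_eq1 ?uS//; ring.
have iu : itg `[c, d]%classic (fun x => plateau c d K x *
        (g x (u x) xi + slope g xi r x (u x) * (du x - xi) - om)).
  have := itgD _ iAu ibu; move=> /(_ ltac:(by [])); apply: eq_integrable => //.
  by move=> x; rewrite inE /= in_itv/= => xcd; rewrite uE.
split=> //.
have -> : \int[mu]_(x in `[c, d]) (plateau c d K x *
        (g x (u x) xi + slope g xi r x (u x) * (du x - xi) - om)) =
   \int[mu]_(x in `[c, d]) A x (u x) + \int[mu]_(x in `[c, d]) (be x (u x) * du x).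
  rewrite -RintegralD//; apply: eq_Rintegral => x.
  by rewrite inE /= in_itv/= => xcd; rewrite uE.
have cN : continuous (fun x => `|w x - u x|).
  by move=> x; apply: cvg_norm; apply: cvgB; [exact: cw|exact: cu].
have iN := itg_continuous c d cN.
have h1 := HC1 w dw u du acw acu.
have h2 : `|\int[mu]_(x in `[c, d]) A x (w x) - \int[mu]_(x in `[c, d]) A x (u x)| <=
    eta / 2 + C2 * \int[mu]_(x in `[c, d]) `|w x - u x|.
  have -> : eta / 2 + C2 * \int[mu]_(x in `[c, d]) `|w x - u x| =
     \int[mu]_(x in `[c, d]) (eta / 2 / (d - c) + C2 * `|w x - u x|).
    rewrite RintegralD//; [|exact: itg_cst|exact: itgZ].
    by rewrite Rintegral_itv_cst// RintegralZl// divfK// gt_eqF// subr_gt0.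
  apply: le_dist_Rintegral => //.
    by apply: itgD => //; [exact: itg_cst|exact: itgZ].
  by move=> x /=; rewrite in_itv/= => xcd; exact: HC2.
have h3 : \int[mu]_(x in `[c, d]) A x (w x) + \int[mu]_(x in `[c, d]) (be x (w x) * dw x) <=
    \int[mu]_(x in `[c, d]) g x (w x) (dw x).
  rewrite -RintegralD//; apply: le_Rintegral => //; first exact: itgD.
  by move=> x /=; rewrite in_itv/= => xcd; exact: minor.
move: h1 h2 h3; rewrite !ler_norml => /andP[h1 _] /andP[h2 _] h3.
rewrite mulrDl.
set L := \int[mu]_(x in `[c, d]) `|w x - u x| in h1 h2 *.
set X1 := \int[mu]_(x in `[c, d]) A x (w x) in h2 h3.
set X2 := \int[mu]_(x in `[c, d]) (be x (w x) * dw x) in h1 h3.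
set Y1 := \int[mu]_(x in `[c, d]) A x (u x) in h2 *.
set Y2 := \int[mu]_(x in `[c, d]) (be x (u x) * du x) in h1 *.
set Z := \int[mu]_(x in `[c, d]) g x (w x) (dw x) in h3 *.
clearbody L X1 X2 Y1 Y2 Z; clear - h1 h2 h3; lra.
Qed.

End cell_estimate.

(** * Step functions in L^1 and measurability of compositions *)

Section step_functions_and_measurability.
Context {R : realType}.
Notation mu := (@lebesgue_measure R).
Implicit Types (u v : R -> R) (g : R -> R -> R -> R).

(** A continuous function close to v in L^1 is sampled at the left ends of a fine grid. *)
Lemma step_approximation (a b tau : R) v : a < b -> itg `[a, b]%classic v -> 0 < tau ->
  exists N (xi : nat -> R), (0 < N)%N /\
    \sum_(i < N) \int[mu]_(x in `[pt a b N i, pt a b N i.+1]) `|v x - xi i| < tau.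
Proof.
move=> ab iv tau0; have abW := ltW ab.
have [k [ck ik kv]] := @approximation_continuous_integrable R `[a, b]%classic v
  (measurable_itv _) (lty_mu_itv a b) iv.
have tau20 : 0 < tau / 2 by rewrite divr_gt0.
have [n Hn] : exists n, \int[mu]_(x in `[a, b]) `|v x - k n x| < tau / 2.
  move/fine_cvgP : kv => [_ /cvgrPdist_lt/(_ _ tau20)[n _ /(_ n)]].
  rewrite sub0r normrN /= leqnn => /(_ isT) H; exists n.
  by rewrite (le_lt_trans (ler_norm _)).
have e0 : 0 < (tau / 2) / (b - a) by rewrite divr_gt0// subr_gt0.
have [de de0 Hde] := compact_unif_continuous (@segment_compact R a b) (ck n) e0.
have [N0 HN0] := mesh_small abW de0.
exists N0.+1, (fun i => k n (pt a b N0.+1 i)); split=> //.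
have hd := HN0 N0.+1 (leqnSn _) isT.
have ivk : itg `[a, b]%classic (fun x => `|v x - k n x|).
  by apply: itg_norm; apply: itgB => //; exact: ik.
apply: (@le_lt_trans _ _ (\int[mu]_(x in `[a, b]) (`|v x - k n x| + (tau / 2) / (b - a)))).
  rewrite (Rintegral_pt abW (ltn0Sn N0) (itgD (measurable_itv _) ivk (itg_cst a b _))).
  apply: ler_sum => -[i iN] _ /=.
  have ai : a <= pt a b N0.+1 i by exact: pt_ge.
  have ib : pt a b N0.+1 i.+1 <= b by exact: pt_le_end.
  have ii : pt a b N0.+1 i <= pt a b N0.+1 i.+1 by exact: pt_le.
  apply: le_Rintegral => //.
  - apply: itg_norm; apply: itgB => //; last exact: itg_cst.
    exact: itg_subitv iv.
  - by apply: itgD => //; [exact: itg_subitv ivk|exact: itg_cst].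
  move=> x /=; rewrite in_itv/= => /andP[ix xi].
  rewrite (_ : v x - _ = (v x - k n x) + (k n x - k n (pt a b N0.+1 i))); last by ring.
  rewrite (le_trans (ler_normD _ _))// lerD2l distrC ltW//.
  apply: Hde; first by rewrite /= in_itv/= ai (le_trans ii).
  rewrite /ball/= distrC ger0_norm ?subr_ge0//; apply: le_lt_trans hd.
  by rewrite -(ptS a b N0.+1 i) lerD2r.
rewrite RintegralD//; last exact: itg_cst.
by rewrite Rintegral_itv_cst// divfK ?gt_eqF ?subr_gt0// [ltRHS]splitr ltrD2r.
Qed.

Definition round (n : nat) (y : R) : R := (Num.floor (n.+1%:R * y))%:~R / n.+1%:R.

Lemma round_cvg (y : R) : round n y @[n --> \oo] --> y.
Proof.
apply/cvgrPdist_le => e e0; near=> n.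
have n0 : 0 < n.+1%:R :> R by rewrite ltr0n.
have /andP[h1 h2] := floor_itv (n.+1%:R * y).
rewrite intrD in h2.
have -> : y - round n y = (n.+1%:R * y - (Num.floor (n.+1%:R * y))%:~R) / n.+1%:R.
  by rewrite /round mulrBl [n.+1%:R * y]mulrC mulfK// gt_eqF.
rewrite ger0_norm ?divr_ge0 ?subr_ge0 ?(ltW n0)// ler_pdivrMr//.
apply: (@le_trans _ _ 1); first by lra.
rewrite mulrC -ler_pdivrMl// mulr1 ltW//; near: n.
exact: near_infty_natSinv_lt (PosNum e0).
Unshelve. all: by end_near. Qed.

(* Rounding [u] and [v] to multiples of 1/(n+1) leaves countably many values, on
   each of which [g] only depends on [x]. *)
Lemma measurable_comp3 g u v (D : set (measurableTypeR R)) : measurable D ->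
  continuous (fun p : R * R * R => g p.1.1 p.1.2 p.2) ->
  measurable_fun D u -> measurable_fun D v -> measurable_fun D (fun x => g x (u x) (v x)).
Proof.
move=> mD cg mu' mv.
apply: (@measurable_fun_cvg _ _ _ D (fun n x => g x (round n (u x)) (round n (v x)))).
  move=> n _ B mB.
  pose U (p : int) := D `&` u @^-1` `[p%:~R / n.+1%:R, (p + 1)%:~R / n.+1%:R[%classic.
  pose V (p : int) := D `&` v @^-1` `[p%:~R / n.+1%:R, (p + 1)%:~R / n.+1%:R[%classic.
  have n0 : 0 < n.+1%:R :> R by rewrite ltr0n.
  have flE (y : R) (p : int) : (Num.floor (n.+1%:R * y) == p) =
     (p%:~R / n.+1%:R <= y < (p + 1)%:~R / n.+1%:R).
    by rewrite floor_eq ler_pdivrMr// ltr_pdivlMr// [y * _]mulrC.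
  rewrite (_ : _ `&` _ = \bigcup_(pq : int * int) (U pq.1 `&` V pq.2 `&`
      (D `&` (fun x => g x (pq.1%:~R / n.+1%:R) (pq.2%:~R / n.+1%:R)) @^-1` B))).
    apply: countable_bigcupT_measurable => [|[p q]]; first exact: countableP.
    have cgpq : continuous (fun x => g x (p%:~R / n.+1%:R) (q%:~R / n.+1%:R)).
      pose sec (x s : R) := g x s (q%:~R / n.+1%:R).
      apply: (@continuous_along _ sec (fun=> p%:~R / n.+1%:R)).
        exact: continuous_section.
      by move=> x; exact: cvg_cst.
    apply: measurableI; first by apply: measurableI; [exact: mu'|exact: mv].
    exact: (measurable_funTS (continuous_measurable_fun cgpq)).
  apply/seteqP; split => [x [Dx Bx]|x [[p q] _ [[[Dx /= up] [_ /= vq]] [_ /= Bx]]]].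
    exists (Num.floor (n.+1%:R * u x), Num.floor (n.+1%:R * v x)) => //=.
    by split=> //; split; split=> //=; rewrite in_itv/= -flE.
  split=> //=; move: up vq; rewrite !in_itv/= -!flE => /eqP up /eqP vq.
  by rewrite /round up vq.
move=> x Dx.
apply: (@cvg_comp _ _ _ (fun n => (x, round n (u x), round n (v x)) : R * R * R)
  (fun p : R * R * R => g p.1.1 p.1.2 p.2)); last exact: (cg (x, u x, v x)).
apply: (@cvg_pair _ _ _ _ (nbhs (x, u x)) (nbhs (v x))); last exact: round_cvg.
by apply: (@cvg_pair _ _ _ _ (nbhs x) (nbhs (u x))); [exact: cvg_cst|exact: round_cvg].
Qed.

End step_functions_and_measurability.

(** * The lower bound on a compact interval *)

Section interval_estimate.
Context {R : realType}.
Notation mu := (@lebesgue_measure R).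
Implicit Types (w dw u du : R -> R) (g : R -> R -> R -> R).

Definition integrand (a b : R) g : Prop :=
  [/\ continuous (fun p : R * R * R => g p.1.1 p.1.2 p.2),
   forall x s z, 0 <= g x s z,
   forall x s y z t, 0 <= t <= 1 ->
     g x s (t * y + (1 - t) * z) <= t * g x s y + (1 - t) * g x s z &
   equi_ac a b g].

(** Bounded on a compact interval when u and g are continuous, hence integrable there even if the
    full integrand is not; equal to the full integrand at x once M >= |du x|. *)
Definition cut_integrand g (M : R) u du (x : R) : R :=
  if `|du x| <= M then g x (u x) (du x) else 0.

Lemma measurable_cut_integrand g M u du (D : set (measurableTypeR R)) :
  measurable D -> continuous (fun p : R * R * R => g p.1.1 p.1.2 p.2) ->
  measurable_fun D u -> measurable_fun D du -> measurable_fun D (cut_integrand g M u du).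
Proof.
move=> mD cg mu' mdu.
have -> : cut_integrand g M u du =
    (fun x => \1_(`[- M, M] : set (measurableTypeR R)) (du x) * g x (u x) (du x)).
  apply/funext => x; rewrite /cut_integrand indicE mem_setE in_itv/= -ler_norml.
  by case: ifPn => _; rewrite ?mul1r ?mul0r.
apply: measurable_funM; last exact: measurable_comp3.
apply: measurableT_comp => //; exact: measurable_indic.
Qed.

(* [du] is approximated in L^1 by a step function [xi]; on a cell where [xi] is
   at most [M + 1] the affine minorant at [xi] is used, the other cells are
   discarded since [g] is nonnegative. The constants [G], [de], [r] and [C2] depend
   on [M] but not on the step function, which can thus be chosen last. *)
Lemma interval_lower_bound (a b M : R) g u du : a < b -> 0 <= M -> integrand a b g ->
  acpair a b u du -> forall eta, 0 < eta ->
  itg `[a, b]%classic (cut_integrand g M u du) /\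
  exists2 C : R, 0 <= C & forall w dw,
    acpair a b w dw -> itg `[a, b]%classic (fun x => g x (w x) (dw x)) ->
    \int[mu]_(x in `[a, b]) cut_integrand g M u du x - eta -
      C * \int[mu]_(x in `[a, b]) `|w x - u x| <=
    \int[mu]_(x in `[a, b]) g x (w x) (dw x).
Proof.
move=> ab M0 [cg g0 cvx eg] acu eta eta0; have abW := ltW ab.
have [cu idu uE] := acu.
have [W W0 HW] := compact_continuous_bounded (@segment_compact R a b) cu.
pose S := W + 1.
have S1 : 1 <= S by rewrite /S lerDr.
have uS x : a <= x <= b -> `|u x| <= S - 1.
  by move=> xab; rewrite /S addrK; apply: HW; rewrite /= in_itv.
(* Room for |xi| <= M + 1 and for the second chord point xi + r, as r < 1. *)
pose K := (`[a, b] `*` `[- S, S] `*` `[- (M + 2), M + 2])%classic : set (R * R * R).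
have cK : compact K.
  by apply: compact_setX; [apply: compact_setX|]; exact: segment_compact.
have Kin x s z : a <= x <= b -> `|s| <= S -> `|z| <= M + 2 -> K (x, s, z).
  by move=> xab sS zM; split; [split|]; rewrite /= in_itv//= -ler_norml.
have [G G0 HG] := compact_continuous_bounded cK cg.
have ba0 : 0 < b - a by rewrite subr_gt0.
(* Budget for eta: 2 e (b - a) = eta / 4 for oscillations, eta / 4 for the step approximation, and
   eta / 2 for the N cells, where cut-off and passage from w to u cost eta / (4 N) each. *)
pose e := eta / (8 * (b - a)).
have e0 : 0 < e by rewrite divr_gt0// mulr_gt0.
have [d1 d10 Hd1] := compact_unif_continuous cK cg e0.
pose de := Num.min d1 1.
have de0 : 0 < de by rewrite lt_min d10 ltr01.
have ded1 : de <= d1 by rewrite /de ge_min lexx.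
have de1 : de <= 1 by rewrite /de ge_min lexx orbT.
clearbody de.
pose r := de / 2.
have r0 : 0 < r by rewrite divr_gt0.
have rde : r < de by rewrite /r; lra.
clearbody r.
have gclose x s y z : a <= x <= b -> `|s| <= S -> `|y| <= M + 2 ->
    `|y - z| < de -> `|g x s y - g x s z| < e.
  move=> xab sS yM yz; apply: (Hd1 (x, s, y) (x, s, z)); first exact: Kin.
  split; first exact: ballxx.
  by rewrite /ball/=; exact: lt_le_trans ded1.
(* The price of replacing du by xi: G / de absorbs [psi] <= G where |du - xi| >= de, and 2 G / r
   bounds the slope. *)
pose C2 := G / de + 2 * G / r.
have Gde0 : 0 <= G / de by apply: divr_ge0 => //; exact: ltW.
have Gr0 : 0 <= 2 * G / r by apply: divr_ge0; [exact: mulr_ge0|exact: ltW].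
have C20 : 0 <= C2 by exact: addr_ge0.
pose psi := cut_integrand g M u du.
have psi_g x : a <= x <= b -> 0 <= psi x <= G.
  move=> xab; rewrite /psi /cut_integrand; case: ifPn => duM; last by rewrite lexx.
  rewrite g0 (le_trans (ler_norm _))//; apply: (HG (x, u x, du x)); apply: Kin => //.
    by rewrite (le_trans (uS _ xab))// lerBlDr lerDl.
  by rewrite (le_trans duM)// lerDl.
have mpsi : measurable_fun `[a, b] psi.
  apply: measurable_cut_integrand => //; last exact: itg_measurable.
  exact: (measurable_funTS (continuous_measurable_fun cu)).
have ipsi : itg `[a, b]%classic psi.
  apply: (@itg_bounded _ _ _ G) => // x /=; rewrite in_itv/= => xab.
  by have /andP[? ?] := psi_g x xab; rewrite ger0_norm.
split => //.
have tau0 : 0 < eta / (4 * (C2 + 1)) by rewrite divr_gt0// mulr_gt0// ltr_wpDl.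
have [N [xi [N0 Hxi]]] := step_approximation ab idu tau0.
have NR0 : 0 < N%:R :> R by rewrite ltr0n.
pose x_ := pt a b N.
pose h := (b - a) / N%:R.
have h0 : 0 < h by rewrite divr_gt0.
have xS i : x_ i.+1 - x_ i = h by rewrite /x_ ptS.
have eta40 : 0 < eta / (4 * N%:R) by rewrite divr_gt0// mulr_gt0.
(* The condition i < N stands under the existential so that [choice] gives one function of i. *)
have cell i : exists C, (i < N)%N -> 0 <= C /\ forall w dw,
    acpair a b w dw -> itg `[a, b]%classic (fun x => g x (w x) (dw x)) ->
    \int[mu]_(x in `[x_ i, x_ i.+1]) psi x - 2 * e * h -
      C2 * \int[mu]_(x in `[x_ i, x_ i.+1]) `|du x - xi i| - 2 * (eta / (4 * N%:R)) -
      C * \int[mu]_(x in `[x_ i, x_ i.+1]) `|w x - u x| <=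
    \int[mu]_(x in `[x_ i, x_ i.+1]) g x (w x) (dw x).
  have [iN|] := ltnP i N; last by exists 0.
  have ac : a <= x_ i by exact: pt_ge.
  have db : x_ i.+1 <= b by exact: pt_le_end.
  have cd : x_ i < x_ i.+1 by rewrite -subr_gt0 xS.
  have cdW := ltW cd.
  have xab x : x_ i <= x <= x_ i.+1 -> a <= x <= b.
    by move=> /andP[h1 h2]; rewrite (le_trans ac)// (le_trans h2).
  have ipsi' : itg `[x_ i, x_ i.+1]%classic psi by exact: itg_subitv ipsi.
  have idx : itg `[x_ i, x_ i.+1]%classic (fun x => `|du x - xi i|).
    by apply: itg_norm; apply: itgB => //; [exact: itg_subitv idu|exact: itg_cst].
  (* On a cell with |xi| > M + 1, either |du| > M and [psi] is 0, or |du - xi| > 1 and G / de >= G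
     absorbs it. The lower bound is then at most 0. *)
  have lowpsi x : x_ i <= x <= x_ i.+1 -> M + 1 < `|xi i| ->
      psi x - C2 * `|du x - xi i| <= 0.
    move=> /xab xx Mxi; have /andP[p0 pG] := psi_g _ xx.
    rewrite /psi /cut_integrand in p0 pG *; case: ifPn p0 pG => duM p0 pG; last first.
      by rewrite sub0r oppr_le0 mulr_ge0.
    have : 1 < `|du x - xi i|.
      have : `|xi i| <= `|du x| + `|du x - xi i|.
        by rewrite addrC -lerBlDr distrC (le_trans _ (lerB_dist _ _)).
      lra.
    move=> H; rewrite subr_le0 (le_trans pG)//.
    apply: (@le_trans _ _ (G / de * 1)).
      by rewrite mulr1 ler_pdivlMr// ler_piMr.
    by apply: ler_pM => //; [rewrite /C2 lerDl|exact: ltW].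
  have [xiM|xiM] := leP `|xi i| (M + 1); last first.
    exists 0 => _; split => // w dw acw iw.
    rewrite mul0r subr0; apply: (@le_trans _ _ 0); last exact: Rintegral_ge0.
    have : \int[mu]_(x in `[x_ i, x_ i.+1]) (psi x - C2 * `|du x - xi i|) <= 0.
      apply: (@le_trans _ _ (\int[mu]_(x in `[x_ i, x_ i.+1]) 0)).
        apply: le_Rintegral => //; [by apply: itgB => //; exact: itgZ|exact: itg_cst|].
        by move=> x /=; rewrite in_itv/= => xx; exact: lowpsi.
      by rewrite Rintegral_itv_cst// mul0r.
    rewrite RintegralB//; last exact: itgZ.
    rewrite RintegralZl//.
    have : 0 <= 2 * e * h.
      by apply: mulr_ge0; [apply: mulr_ge0|]; rewrite ?(ltW e0) ?(ltW h0).
    move: eta40; clear; lra.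
  (* Steep enough that the end layers lose at most G times 2 / Kb, which is at most eta / (4 N). *)
  pose Kb := 8 * N%:R * (G + 1) / eta.
  have Kb0 : 0 < Kb by rewrite divr_gt0// mulr_gt0 ?mulr_gt0// ltr_wpDl.
  have osc x s z : x_ i <= x <= x_ i.+1 -> `|s| <= S -> xi i <= z <= xi i + r ->
    `|g x s (xi i) - g x s z| <= e /\ `|g x s (xi i + r) - g x s z| <= e.
    move=> /xab xx sS /andP[z1 z2].
    split; rewrite ltW//; apply: gclose => //.
    - by rewrite (le_trans xiM)// lerD2l ler1n.
    - by apply: le_lt_trans rde; rewrite ler0_norm; clear -z1 z2; lra.
    - rewrite (le_trans (ler_normD _ _))// (gtr0_norm r0); clear -xiM rde de1; lra.
    - by apply: le_lt_trans rde; rewrite ger0_norm; clear -z1 z2; lra.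
  have acu' : acpair (x_ i) (x_ i.+1) u du by exact: acpair_sub acu.
  have [C C0 HC] := cell_lower_bound ac cd db r0 (ltW Kb0) S1 cg eg g0 cvx osc acu'
    (fun x xx => uS x (xab x xx)) eta40.
  exists C => _; split => // w dw acw iw.
  have acw' : acpair (x_ i) (x_ i.+1) w dw by exact: acpair_sub acw.
  have iw' : itg `[x_ i, x_ i.+1]%classic (fun x => g x (w x) (dw x)).
    exact: itg_subitv iw.
  have [iL HL] := HC w dw acw' iw'.
  apply: le_trans HL.
  set P := plateau _ _ _.
  rewrite lerD2r -subr_ge0.
  set I1 := \int[mu]_(x in _) psi x.
  set I2 := \int[mu]_(x in _) `|du x - xi i|.
  set I3 := \int[mu]_(x in _) (P x * _).
  suff : I1 - 2 * e * h - C2 * I2 - eta / (4 * N%:R) <= I3 by clear; lra.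
  have iP : itg `[x_ i, x_ i.+1]%classic (fun x => 1 - P x).
    apply: itgB => //; first exact: itg_cst.
    by apply: itg_continuous; apply: plateau_continuous; exact: ltW.
  have HP : G * \int[mu]_(x in `[x_ i, x_ i.+1]) (1 - P x) <= eta / (4 * N%:R).
    apply: (le_trans (ler_wpM2l G0 (plateau_integral _ _ Kb0))).
    rewrite /Kb invf_div (_ : G * (2 * _) = eta / (4 * N%:R) * (G / (G + 1))).
      rewrite ler_piMr ?(ltW eta40)// ler_pdivrMr ?mul1r ?lerDl// ltr_wpDl//.
    field; rewrite gt_eqF//= ?gt_eqF// ltr_wpDl//.
  suff : I1 - 2 * e * h - C2 * I2 - G * \int[mu]_(x in `[x_ i, x_ i.+1]) (1 - P x) <= I3.
    by move: HP; clear; lra.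
  have i2e : itg `[x_ i, x_ i.+1]%classic (fun=> 2 * e) by exact: itg_cst.
  have iC : itg `[x_ i, x_ i.+1]%classic (fun x => C2 * `|du x - xi i|) by exact: itgZ.
  have iD : itg `[x_ i, x_ i.+1]%classic (fun x => G * (1 - P x)) by exact: itgZ.
  have iAB : itg `[x_ i, x_ i.+1]%classic (fun x => psi x - 2 * e) by exact: itgB.
  have iABC : itg `[x_ i, x_ i.+1]%classic (fun x => psi x - 2 * e - C2 * `|du x - xi i|).
    exact: itgB.
  have -> : I1 - 2 * e * h - C2 * I2 - G * \int[mu]_(x in `[x_ i, x_ i.+1]) (1 - P x) =
      \int[mu]_(x in `[x_ i, x_ i.+1])
        (psi x - 2 * e - C2 * `|du x - xi i| - G * (1 - P x)).
    rewrite (RintegralB _ iABC iD)// (RintegralB _ iAB iC)// (RintegralB _ ipsi' i2e)//.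
    by rewrite Rintegral_itv_cst// xS !RintegralZl.
  apply: le_Rintegral => //; first exact: (itgB _ iABC iD).
  move=> x /=; rewrite in_itv/= => xx.
  have xx' := xab _ xx.
  have P0 : 0 <= P x by exact: clip_ge0.
  have P1 : P x <= 1 by exact: clip_le1.
  have /andP[p0 pG] := psi_g _ xx'.
  have uSx : `|u x| <= S by rewrite (le_trans (uS _ xx'))// lerBlDr lerDl.
  have gG z : `|z| <= M + 2 -> g x (u x) z <= G.
    by move=> zM; rewrite (le_trans (ler_norm _))//; apply: (HG (x, u x, z)); exact: Kin.
  set q := slope _ _ _ _ _.
  set y := `|du x - xi i|.
  have y0 : 0 <= y by exact: normr_ge0.
  have qb : `|q| <= 2 * G / r.
    rewrite /q /slope normrM [`|r^-1|]gtr0_norm ?invr_gt0// ler_pM2r ?invr_gt0//.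
    rewrite (le_trans (ler_normB _ _))// mulr_natl mulr2n lerD// ger0_norm ?g0//.
      by apply: gG; rewrite (le_trans (ler_normD _ _))// (gtr0_norm r0); clear -xiM rde de1; lra.
    by apply: gG; rewrite (le_trans xiM)// lerD2l ler1n.
  have qy : - (2 * G / r * y) <= q * (du x - xi i).
    rewrite lerNl (le_trans (ler_norm _))// normrN normrM.
    by rewrite ler_wpM2r.
  have gpsi : psi x - e - G / de * y <= g x (u x) (xi i).
    have Gy0 : 0 <= G / de * y by exact: mulr_ge0.
    have [yde|yde] := ltP y de; last first.
      have : G <= G / de * y by rewrite mulrAC ler_pdivlMr// ler_wpM2l.
      by move: (g0 x (u x) (xi i)) e0 pG; clear; lra.
    rewrite /psi /cut_integrand; case: ifPn => duM.
      have : `|g x (u x) (du x) - g x (u x) (xi i)| < e.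
        by apply: gclose => //; rewrite (le_trans duM)// lerDl.
      by rewrite ltr_norml => /andP[_]; move: Gy0; clear; lra.
    by move: (g0 x (u x) (xi i)) Gy0 e0; clear; lra.
  have Ge0 : 0 <= e + G / de * y.
    by apply: addr_ge0; [exact: ltW|exact: mulr_ge0].
  have Gr : 0 <= e + 2 * G / r * y.
    by apply: addr_ge0; [exact: ltW|exact: mulr_ge0].
  have k1 : psi x - (1 - P x) * G - (e + G / de * y) <= P x * g x (u x) (xi i).
    apply: (@le_trans _ _ (P x * (psi x - (e + G / de * y)))); last first.
      by rewrite ler_wpM2l// opprD addrA.
    have : (1 - P x) * psi x <= (1 - P x) * G by rewrite ler_wpM2l// subr_ge0.
    have : P x * (e + G / de * y) <= e + G / de * y by rewrite ler_piMl.
    clear; lra.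
  have k2 : - (e + 2 * G / r * y) <= P x * (q * (du x - xi i) - e).
    apply: (@le_trans _ _ (P x * (- (e + 2 * G / r * y)))).
      by rewrite mulrN lerN2 ler_piMl.
    by rewrite ler_wpM2l// opprD addrC lerD2r.
  rewrite /C2; move: k1 k2; clear; lra.
have [Cf HCf] := choice cell.
exists (\sum_(i < N) Cf i).
  by apply: sumr_ge0 => -[i iN] _; have [] := HCf i iN.
move=> w dw acw iw.
have [cw _ _] := acw.
have iwu : itg `[a, b]%classic (fun x => `|w x - u x|).
  apply: itg_continuous => x.
  by apply: cvg_norm; apply: cvgB; [exact: cw|exact: cu].
rewrite (Rintegral_pt abW N0 iw) (Rintegral_pt abW N0 ipsi) -/x_.
apply: (@le_trans _ _ (\sum_(i < N) (\int[mu]_(x in `[x_ i, x_ i.+1]) psi x - 2 * e * h -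
      C2 * \int[mu]_(x in `[x_ i, x_ i.+1]) `|du x - xi i| - 2 * (eta / (4 * N%:R)) -
      Cf i * \int[mu]_(x in `[x_ i, x_ i.+1]) `|w x - u x|))); last first.
  by apply: ler_sum => -[i iN] _; have [_] := HCf i iN; apply.
rewrite !sumrB !sumr_const card_ord -mulr_sumr.
have k1 : C2 * \sum_(i < N) \int[mu]_(x in `[x_ i, x_ i.+1]) `|du x - xi i| <= eta / 4.
  apply: (@le_trans _ _ ((C2 + 1) * (eta / (4 * (C2 + 1))))).
    by apply: ler_pM; rewrite ?lerDl// ?(ltW Hxi)//; apply: sumr_ge0 => i _; exact: Rintegral_ge0.
  rewrite (_ : (C2 + 1) * _ = eta / 4)//; field.
  by rewrite gt_eqF// ltr_wpDl.
have k2 : 2 * e * h *+ N = eta / 4.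
  rewrite -mulr_natr /e /h; field.
  by rewrite !gt_eqF.
have k3 : 2 * (eta / (4 * N%:R)) *+ N = eta / 2.
  by rewrite -mulr_natr; field; rewrite gt_eqF.
have k4 : \sum_(i < N) (Cf i * \int[mu]_(x in `[x_ i, x_ i.+1]) `|w x - u x|) <=
    (\sum_(i < N) Cf i) * \int[mu]_(x in `[a, b]) `|w x - u x|.
  rewrite mulr_suml; apply: ler_sum => -[i iN] _ /=.
  have [Ci0 _] := HCf i iN; rewrite ler_wpM2l//.
  rewrite (Rintegral_pt abW N0 iwu) (bigD1 (Ordinal iN))//= lerDl.
  by apply: sumr_ge0 => j _; exact: Rintegral_ge0.
rewrite k2 k3; move: k1 k4; rewrite -/psi; clear; lra.
Qed.

End interval_estimate.

(** * A smooth step function *)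

Section smooth_step_function.
Context {R : realType}.
Implicit Types f g : R -> R.

(** Finite-order smoothness with an explicit derivative at each order: closure under products,
    inverses and affine changes of variable becomes an induction on n. *)
Fixpoint nsmooth (n : nat) f : Prop :=
  if n is m.+1 then
    exists2 g, (forall x, is_derive x (1 : R) f (g x)) & nsmooth m g
  else True.

Lemma nsmooth_smooth f : (forall n, nsmooth n f) -> smooth f.
Proof.
move=> H n x; have := H n.+1; elim: n f {H} => [|n IHn] f [g fg gn].
  by have [] := fg x.
rewrite iterSr; have -> : f^`()%classic = g.
  by apply/funext => y; rewrite derive1E; have [] := fg y.
exact: IHn gn.
Qed.

Lemma nsmoothW n f : nsmooth n.+1 f -> nsmooth n f.
Proof.
by elim: n f => //= n IHn f [g fg [h gh hn]]; exists g => //; apply: IHn; exists h.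
Qed.

Lemma nsmooth_eq n f g : f =1 g -> nsmooth n f -> nsmooth n g.
Proof. by move=> /funext ->. Qed.

Lemma nsmoothD n f g : nsmooth n f -> nsmooth n g -> nsmooth n (fun x => f x + g x).
Proof.
elim: n f g => //= n IHn f g [f' ff' f'n] [g' gg' g'n].
exists (fun x => f' x + g' x); last exact: IHn.
by move=> x; exact: is_deriveD (ff' x) (gg' x).
Qed.

Lemma nsmooth_cst n (c : R) : nsmooth n (fun=> c).
Proof.
elim: n c => //= n IHn c; exists (fun=> 0) => // x; exact: is_derive_cst.
Qed.

Lemma nsmoothM n f g : nsmooth n f -> nsmooth n g -> nsmooth n (fun x => f x * g x).
Proof.
elim: n f g => [|n IHn] f g //.
move=> fn gn; have fnW := nsmoothW fn; have gnW := nsmoothW gn.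
case: fn => f' ff' f'n; case: gn => g' gg' g'n.
exists (fun x => f x * g' x + g x * f' x).
  by move=> x; exact: is_deriveM (ff' x) (gg' x).
by apply: nsmoothD; exact: IHn.
Qed.

Lemma nsmoothZ n (c : R) f : nsmooth n f -> nsmooth n (fun x => c * f x).
Proof. by apply: nsmoothM; exact: nsmooth_cst. Qed.

Lemma nsmoothV n f : (forall x, f x != 0) -> nsmooth n f -> nsmooth n (fun x => (f x)^-1).
Proof.
move=> f0; elim: n => [|n IHn] // fn; have fnW := IHn (nsmoothW fn).
case: fn => f' ff' f'n.
exists (fun x => (- 1) * (((f x)^-1 * (f x)^-1) * f' x)).
  move=> x; apply: is_derive_eq (@is_deriveV _ f x (f' x) 1 (f0 x) (ff' x)) _.
  by rewrite /GRing.scale/=; field; exact: f0.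
by apply: nsmoothZ; apply: nsmoothM => //; exact: nsmoothM.
Qed.

Lemma nsmooth_affine n (a b : R) f : nsmooth n f -> nsmooth n (fun x => f (a * x + b)).
Proof.
elim: n f => [|n IHn] f // [f' ff' f'n].
exists (fun x => a * f' (a * x + b)); last by apply: nsmoothZ; exact: IHn.
move=> x.
have dab : is_derive x (1 : R) (fun x => a * x + b) a.
  have dab := is_deriveD (is_deriveZ a (is_derive_id x 1)) (is_derive_cst b x (1 : R)).
  by apply: is_derive_eq dab _; rewrite addr0 /GRing.scale/= mulr1.
by rewrite mulrC; exact: (@is_derive1_comp _ f (fun x => a * x + b) x _ _ (ff' _) dab).
Qed.

Lemma is_derive_exp k f (x df : R) : is_derive x (1 : R) f df ->
  is_derive x (1 : R) (fun t => f t ^+ k) (k%:R * f x ^+ k.-1 * df).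
Proof.
move=> dfx; elim: k => [|k IHk].
  by rewrite !mul0r; exact: is_derive_cst.
have -> : (fun t => f t ^+ k.+1) = (fun t => f t * f t ^+ k).
  by apply/funext => t; rewrite exprS.
apply: is_derive_eq (is_deriveM dfx IHk) _; rewrite /GRing.scale/=.
by case: k {IHk} => [|k]; rewrite ?expr0 /= -?natr1 ?exprS; ring.
Qed.

(* The family t^(-k) exp(-1/t) is stable under differentiation up to linear
   combinations. *)
Definition flat (k : nat) (t : R) : R :=
  if 0 < t then t^-1 ^+ k * expR (- t^-1) else 0.

Lemma flat_gt0 k t : 0 < t -> 0 < flat k t.
Proof. by move=> t0; rewrite /flat t0 mulr_gt0 ?expR_gt0// exprn_gt0// invr_gt0. Qed.

Lemma flat_ge0 k t : 0 <= flat k t.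
Proof. by have [/(flat_gt0 k)/ltW//|t0] := ltP 0 t; rewrite /flat ltNge t0. Qed.

Lemma flat_le0 k t : t <= 0 -> flat k t = 0.
Proof. by move=> t0; rewrite /flat ltNge t0. Qed.

(** For t > 0, one term of the exponential series gives t^(-k-1) <= (k+1)! exp(1/t). A bound linear
    in |t| is enough for differentiability at 0, since for h > 0 the difference quotient of [flat k]
    there is [flat k.+1]. *)
Lemma flat_le k t : flat k t <= k.+1`!%:R * `|t|.
Proof.
have [t0|t0] := ltP 0 t; last by rewrite flat_le0// mulr_ge0.
rewrite /flat t0 gtr0_norm// expRN.
have ti : 0 < t^-1 by rewrite invr_gt0.
rewrite ler_pdivrMr ?expR_gt0//.
have H : t^-1 ^+ k.+1 / k.+1`!%:R <= expR t^-1.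
  by rewrite (le_trans _ (expR_ge1Dxn k (ltW ti)))// lerDr.
rewrite ler_pdivrMr ?ltr0n ?fact_gt0// in H.
have := ler_wpM2l (ltW t0) H.
by rewrite exprS mulrA divff ?mul1r ?gt_eqF//; congr (_ <= _); ring.
Qed.

Lemma is_derive_flat k x :
  is_derive x (1 : R) (flat k) (flat k.+2 x - k%:R * flat k.+1 x).
Proof.
have [x0|x0|->] := ltgtP x 0.
- rewrite !flat_le0 ?(ltW x0)// mulr0 subrr.
  apply: (@near_eq_is_derive _ _ _ (cst 0)).
  near=> y; rewrite flat_le0//; apply: ltW; near: y; exact: lt_nbhsl.
- have flE j t : 0 < t -> flat j t = t^-1 ^+ j * expR (- t^-1).
    by move=> t0; rewrite /flat t0.
  rewrite !flE//.
  apply: (@near_eq_is_derive _ _ _ (fun t : R => t^-1 ^+ k * expR (- t^-1) : R)).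
    near=> y; rewrite flE//; near: y; exact: lt_nbhsr.
  have xn0 : x != 0 by rewrite gt_eqF.
  have dV : is_derive x (1 : R) (fun t : R => t^-1) (- x ^- 2 *: (1 : R)).
    exact: (@is_deriveV _ id x 1 1 xn0 (is_derive_id x 1)).
  have dX := is_derive_exp k dV.
  have dN := is_deriveN dV.
  have dE := @is_derive1_comp _ expR (fun t : R => - t^-1) x _ _ (is_derive_expR (- x^-1)) dN.
  apply: is_derive_eq (is_deriveM dX dE) _.
  rewrite /GRing.scale/= !mulr1 opprK.
  case: k {dX} => [|k]; first by rewrite !expr0 mulr0n !mul0r mulr0 addr0 subr0 mul1r mulrC exprVn.
  rewrite /= !exprVn !exprS; field.
  by rewrite xn0 /= expf_neq0.
rewrite !flat_le0// mulr0 subrr.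
have H : h^-1 *: (flat k (h *: 1 + 0) - flat k 0) @[h --> 0^'] --> (0 : R).
  have F0 : \forall h \near (0 : R)^', `|h^-1 *: (flat k (h *: 1 + 0) - flat k 0)| <=
      k.+2`!%:R * `|h|.
    near=> h; rewrite addr0 [h *: 1]mulr1 (flat_le0 k (lexx 0)) subr0.
    have [h0|h0] := ltP 0 h; last by rewrite flat_le0// scaler0 normr0 mulr_ge0.
    apply: le_trans (flat_le k.+1 h).
    rewrite /flat h0 /GRing.scale/= mulrA -exprS -/(flat k.+1 h).
    by rewrite ger0_norm// mulr_ge0 ?expR_ge0// exprn_ge0// invr_ge0 ltW.
  apply/cvgrPdist_le => e e0.
  near=> h; rewrite sub0r normrN; apply: (@le_trans _ _ (k.+2`!%:R * `|h|)).
    by near: h.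
  rewrite mulrC -ler_pdivlMr ?ltr0n ?fact_gt0//.
  by near: h; apply: dnbhs0_le; rewrite divr_gt0// ltr0n fact_gt0.
apply: DeriveDef; first exact: cvgP H.
exact: cvg_lim H.
Unshelve. all: by end_near. Qed.

Lemma nsmooth_flat n k : nsmooth n (flat k).
Proof.
elim: n k => //= n IHn k; exists (fun x => flat k.+2 x + (- k%:R) * flat k.+1 x).
  by move=> x; rewrite mulNr; exact: is_derive_flat.
by apply: nsmoothD; [exact: IHn|apply: nsmoothZ; exact: IHn].
Qed.

Definition sstep (t : R) : R := flat 0 t / (flat 0 t + flat 0 (1 - t)).

Lemma sstep_den_gt0 t : 0 < flat 0 t + flat 0 (1 - t).
Proof.
have [t0|t0] := ltP 0 t; first by rewrite ltr_pwDl ?flat_gt0 ?flat_ge0.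
by rewrite ltr_wpDl ?flat_ge0// flat_gt0//; lra.
Qed.

Lemma nsmooth_sstep n : nsmooth n sstep.
Proof.
apply: nsmoothM; first exact: nsmooth_flat.
apply: nsmoothV; first by move=> x; rewrite gt_eqF ?sstep_den_gt0.
apply: nsmoothD; first exact: nsmooth_flat.
apply: (@nsmooth_eq _ (fun x => flat 0 (-1 * x + 1))).
  by move=> x; rewrite mulN1r addrC.
by apply: nsmooth_affine; exact: nsmooth_flat.
Qed.

Lemma sstep_le0 t : t <= 0 -> sstep t = 0.
Proof. by move=> t0; rewrite /sstep flat_le0// mul0r. Qed.

Lemma sstep_ge1 t : 1 <= t -> sstep t = 1.
Proof.
move=> t1; rewrite /sstep [flat 0 (1 - t)]flat_le0 ?subr_le0// addr0 divff//.
by rewrite gt_eqF// flat_gt0// (lt_le_trans ltr01).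
Qed.

Lemma sstep_ge0 t : 0 <= sstep t.
Proof. by rewrite divr_ge0 ?flat_ge0// ltW// sstep_den_gt0. Qed.

Lemma sstep_le1 t : sstep t <= 1.
Proof. by rewrite ler_pdivrMr ?sstep_den_gt0// mul1r lerDl flat_ge0. Qed.

End smooth_step_function.

(** * The fundamental theorem for weak derivatives *)

Section clamping.
Context {R : realType}.
Notation mu := (@lebesgue_measure R).

Definition clamp (a b x : R) : R := Num.max a (Num.min b x).

Lemma clamp_in a b x : a <= b -> a <= clamp a b x <= b.
Proof. by move=> ab; rewrite /clamp le_max lexx/= ge_max ab ge_min lexx. Qed.

Lemma clamp_id a b x : a <= x <= b -> clamp a b x = x.
Proof. by move=> /andP[ax xb]; rewrite /clamp (min_idPr xb); apply/max_idPr. Qed.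

Lemma clamp_continuous a b : continuous (clamp a b).
Proof.
apply: (@lipschitz_continuous _ _ 1) => x y; rewrite mul1r.
by apply: dist_max_le; [|apply: dist_min_le]; rewrite ?subrr ?normr0.
Qed.

Lemma continuous_within_comp (T U V : topologicalType) (A : set U) (f : U -> V)
    (h : T -> U) :
  continuous h -> (forall t, A (h t)) -> {within A, continuous f} ->
  continuous (fun t => f (h t)).
Proof.
move=> ch Ah /subspace_continuousP cf t B /(cf _ (Ah t)) HB.
have := ch t _ HB; rewrite !near_simpl /=.
by apply: filterS => s /(_ (Ah s)).
Qed.

(** Clamping the endpoint gives continuity on the whole line, as [acpair] demands. *)
Lemma primitive_clamp_continuous (a b : R) (k : R -> R) : a <= b ->
  itg `[a, b]%classic k ->
  continuous (fun x => \int[mu]_(t in `[a, clamp a b x]) k t).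
Proof.
move=> ab ik.
apply: (@continuous_within_comp _ _ _ `[a, b]%classic
  (fun x => \int[mu]_(t in `[a, x]) k t) (clamp a b)).
- exact: clamp_continuous.
- by move=> t; rewrite /= in_itv/= clamp_in.
- exact: parameterized_integral_continuous.
Qed.

Lemma Rintegral_indicM (a b p q : R) (k : R -> R) : a <= p -> q <= b ->
  itg `[a, b]%classic k ->
  itg `[a, b]%classic (fun t => \1_(`[p, q] : set (measurableTypeR R)) t * k t) /\
  \int[mu]_(t in `[a, b]) (\1_(`[p, q] : set (measurableTypeR R)) t * k t) =
  \int[mu]_(t in `[p, q]) k t.
Proof.
move=> ap qb ik; split.
  apply: (@itgM _ _ _ _ 1) => //.
  by move=> x _; rewrite indicE ger0_norm//; case: (_ \in _).
rewrite -[in RHS](@setIidr _ `[a, b]%classic `[p, q]%classic); last exact: sub_itvcc.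
rewrite Rintegral_mkcondr; apply: eq_Rintegral => t _.
by rewrite patchE indicE; case: ifP; rewrite ?mul1r ?mul0r.
Qed.

End clamping.

(** * One-sided mollification at Lebesgue points *)

Section du_bois_reymond.
Context {R : realType}.
Notation mu := (@lebesgue_measure R).
Implicit Types (u v : R -> R).

Definition dsstep : R -> R := (@sstep R)^`()%classic.

Lemma is_derive_sstep x : is_derive x (1 : R) (@sstep R) (dsstep x).
Proof.
have [g Hg _] := @nsmooth_sstep R 1.
rewrite /dsstep (_ : _^`()%classic = g) //.
by apply/funext => y; rewrite derive1E; have [] := Hg y.
Qed.

Lemma dsstep_continuous : continuous dsstep.
Proof.
have [g Hg [h Hh _]] := @nsmooth_sstep R 2.
have -> : dsstep = g.
  by apply/funext => y; rewrite /dsstep derive1E; have [] := Hg y.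
move=> x; apply/differentiable_continuous/derivable1_diffP.
by have [] := Hh x.
Qed.

Lemma dsstep_eq0 t : (t < 0) || (1 < t) -> dsstep t = 0.
Proof.
rewrite /dsstep derive1E => /orP[t0|t1].
  rewrite -(@near_eq_derive _ _ _ (cst (0 : R))) ?derive_cst//.
  by near=> y; rewrite sstep_le0//; apply: ltW; near: y; exact: lt_nbhsl.
rewrite -(@near_eq_derive _ _ _ (cst (1 : R))) ?derive_cst//.
by near=> y; rewrite sstep_ge1//; apply: ltW; near: y; exact: lt_nbhsr.
Unshelve. all: by end_near. Qed.

Lemma dsstep_bounded : exists2 C : R, 0 <= C & forall t, `|dsstep t| <= C.
Proof.
have [C C0 HC] := compact_continuous_bounded (@segment_compact R 0 1) dsstep_continuous.
exists C => // t.
have [t0|t0] := ltP t 0; first by rewrite dsstep_eq0 ?t0// normr0.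
have [t1|t1] := ltP 1 t; first by rewrite dsstep_eq0 ?t1 ?orbT// normr0.
by apply: HC; rewrite /= in_itv/= t0.
Qed.

(** A smooth Heaviside function rising on [x, x + e]; the argument has the shape a t + b of
    [nsmooth_affine]. *)
Definition ramp (e x t : R) : R := sstep (e^-1 * t + - (e^-1 * x)).
Definition dramp (e x t : R) : R := e^-1 * dsstep (e^-1 * t + - (e^-1 * x)).

Lemma rampE (e x t : R) : e^-1 * t + - (e^-1 * x) = e^-1 * (t - x).
Proof. by ring. Qed.

Lemma ramp_le (e x t : R) : 0 < e -> t <= x -> ramp e x t = 0.
Proof.
by move=> e0 tx; rewrite /ramp rampE sstep_le0// pmulr_rle0 ?invr_gt0// subr_le0.
Qed.

Lemma ramp_ge (e x t : R) : 0 < e -> x + e <= t -> ramp e x t = 1.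
Proof.
by move=> e0 tx; rewrite /ramp rampE sstep_ge1// ler_pdivlMl// mulr1 lerBrDl.
Qed.

Lemma is_derive_ramp (e x t : R) : is_derive t (1 : R) (ramp e x) (dramp e x t).
Proof.
have dab := is_deriveD (is_deriveZ e^-1 (is_derive_id t 1))
  (is_derive_cst (- (e^-1 * x)) t (1 : R)).
have dab' : is_derive t (1 : R) (fun t => e^-1 * t + - (e^-1 * x)) e^-1.
  by apply: is_derive_eq dab _; rewrite addr0 /GRing.scale/= mulr1.
rewrite /dramp mulrC.
exact: (@is_derive1_comp _ (@sstep R) (fun t => e^-1 * t + - (e^-1 * x)) t _ _
  (is_derive_sstep _) dab').
Qed.

Lemma dramp_continuous (e x : R) : continuous (dramp e x).
Proof.
move=> t; apply: cvgM; first exact: cvg_cst.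
apply: (@continuous_comp _ _ _ (fun t => e^-1 * t + - (e^-1 * x)) dsstep);
  last exact: dsstep_continuous.
apply: cvgD; last exact: cvg_cst.
by apply: cvgM; [exact: cvg_cst|exact: cvg_id].
Qed.

Lemma dramp_eq0 (e x t : R) : 0 < e -> (t < x) || (x + e < t) -> dramp e x t = 0.
Proof.
move=> e0 H; rewrite /dramp rampE dsstep_eq0 ?mulr0//.
rewrite pmulr_rlt0 ?invr_gt0// subr_lt0 ltr_pdivlMl// mulr1 ltrBrDl.
by [].
Qed.

Lemma Rintegral_dramp (e x a b : R) : 0 < e -> a <= x -> x + e <= b ->
  \int[mu]_(t in `[a, b]) dramp e x t = 1.
Proof.
move=> e0 ax xb; rewrite /Rintegral.
rewrite (@continuous_FTC2 _ (dramp e x) (ramp e x)).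
- by rewrite (ramp_le e0 ax) (ramp_ge e0 xb) sube0.
- by rewrite (le_lt_trans ax)// (lt_le_trans _ xb)// ltrDl.
- by apply: continuous_subspaceT; exact: dramp_continuous.
- have cr t : {for t, continuous (ramp e x)}.
    apply/differentiable_continuous/derivable1_diffP.
    by have [] := is_derive_ramp e x t.
  split.
  + by move=> t _; have [] := is_derive_ramp e x t.
  + exact: cvg_at_right_filter (cr a).
  + exact: cvg_at_left_filter (cr b).
- by move=> t _; rewrite derive1E; have [] := is_derive_ramp e x t.
Qed.

(** [dramp e x] has mass 1, lives on [x, x + e] and is at most C / e in modulus, so the error is C
    times a one-sided mean of |u - u(x)|. *)
Lemma mollified_value u (C e x a b : R) : (forall t, `|dsstep t| <= C) ->
  0 < e -> a <= x -> x + e <= b -> itg `[a, b]%classic u ->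
  `|\int[mu]_(t in `[a, b]) (u t * dramp e x t) - u x| <=
  C * (e^-1 * \int[mu]_(t in `[x, x + e]) `|u t - u x|).
Proof.
move=> HC e0 ax xb iu; have ei0 : 0 < e^-1 by rewrite invr_gt0.
have dC t : `|dramp e x t| <= e^-1 * C.
  by rewrite normrM gtr0_norm// ler_pM2l.
have mdr : measurable_fun `[a, b] (dramp e x).
  by apply: measurable_funTS; apply: continuous_measurable_fun; exact: dramp_continuous.
have iud k : itg `[a, b]%classic k -> itg `[a, b]%classic (fun t => k t * dramp e x t).
  move=> ik; have := @itgM _ _ _ _ (e^-1 * C) (measurable_itv _) mdr (fun t _ => dC t) ik.
  by apply: eq_integrable => // t _ /=; rewrite mulrC.
have iux : itg `[a, b]%classic (fun t => u t - u x) by apply: itgB => //; exact: itg_cst.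
have -> : u x = \int[mu]_(t in `[a, b]) (u x * dramp e x t).
  rewrite RintegralZl//; last by apply: itg_continuous; exact: dramp_continuous.
  by rewrite Rintegral_dramp// mulr1.
rewrite -RintegralB//; [|exact: iud|by apply: iud; exact: itg_cst].
(* The previous rewriting also replaced [u x] inside the right-hand side; this restores it. *)
rewrite [X in C * (_ * X)](_ : _ = \int[mu]_(t in `[x, x + e]) `|u t - u x|); last first.
  apply: eq_Rintegral => t _; rewrite RintegralZl//; last first.
    by apply: itg_continuous; exact: dramp_continuous.
  by rewrite Rintegral_dramp// mulr1.
have [i1 E1] := Rintegral_indicM ax xb (itg_norm iux).
rewrite -E1 mulrA -RintegralZl//.
apply: (le_trans (le_normr_Rintegral _ _)) => //.
  by apply: itgB => //; apply: iud => //; exact: itg_cst.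
apply: le_Rintegral => //; [|exact: itgZ|].
  by apply: itg_norm; apply: itgB => //; apply: iud => //; exact: itg_cst.
move=> t _; rewrite -mulrBl normrM indicE mem_setE in_itv/=.
have [xt|tx] := leP x t; last by rewrite dramp_eq0 ?tx// normr0 !mulr0 mul0r mulr0.
have [te|et] := leP t (x + e); last by rewrite dramp_eq0 ?et ?orbT// normr0 !mulr0 mul0r mulr0.
by rewrite /= mul1r mulrC ler_wpM2r// [C * _]mulrC.
Qed.

(** The ball of radius e has measure 2 e, so the right-hand mean is at most twice the symmetric
    mean, which tends to 0; hence eta / 2 below. *)
Lemma lebesgue_pt_right_average u (a b x eta : R) : a < x -> x < b ->
  itg `[a, b]%classic u -> lebesgue_pt (u \_ `[a, b]) x -> 0 < eta ->
  \forall e \near 0^'+, e^-1 * \int[mu]_(t in `[x, x + e]) `|u t - u x| <= eta.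
Proof.
move=> ax xb iu lx eta0.
have eta20 : (0 < (eta / 2)%:E)%E by rewrite lte_fin divr_gt0.
have mU : measurable_fun setT (u \_ `[a, b]).
  by apply/(measurable_restrictT _ _).1 => //; exact: itg_measurable iu.
have lx' : \forall e \near 0^'+, (davg (u \_ `[a, b]) x e < (eta / 2)%:E)%E.
  by move: lx; rewrite /lebesgue_pt => /(_ [set y | (y < (eta / 2)%:E)%E]); apply;
    exact: lt_nbhsl.
near=> e.
have e0 : 0 < e by near: e; exact: nbhs_right_gt.
have eb : x + e <= b.
  rewrite -lerBrDl; near: e; apply: nbhs_right_le; by rewrite subr_gt0.
have ea : a <= x by exact: ltW.
have : (davg (u \_ `[a, b]) x e < (eta / 2)%:E)%E by near: e.
rewrite /davg /iavg (lebesgue_measure_ball _ (ltW e0)) inver mulrn_eq0/= gt_eqF//.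
set I := (\int[mu]_(y in ball x e) _)%E => HI.
have iux : itg `[x, x + e]%classic (fun t => `|u t - u x|).
  apply: itg_norm; apply: itgB => //; last exact: itg_cst.
  by apply: itg_subitv iu.
have LI : ((\int[mu]_(t in `[x, x + e]) `|u t - u x|)%:E <= I)%E.
  rewrite /Rintegral fineK; last exact: integrable_fin_num.
  rewrite -integral_itv_bndo_bndc; last first.
    apply: measurable_funS (measurable_int mu iux) => //.
    by apply: subset_itvl; rewrite bnd_simp.
  rewrite (@eq_integral _ _ _ mu _
    (fun t => `|(center ((u \_ `[a, b]) x) \o (u \_ `[a, b])) t|%:E)); last first.
    move=> t; rewrite inE /= in_itv/= => /andP[xt te].
    rewrite /= !patchE !mem_setE !in_itv/= ea (ltW xb)/=.
    by rewrite (le_trans ea xt) (le_trans (ltW te) eb).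
  apply: ge0_subset_integral => //.
  - exact: measurable_ball.
  - apply/measurable_EFinP; apply: measurableT_comp => //.
    by apply: (measurable_funB (measurable_funTS mU)); exact: measurable_cst.
  - move=> t /=; rewrite in_itv/= => /andP[xt te].
    by rewrite /ball/= distrC ger0_norm ?subr_ge0// ltrBlDl.
rewrite ler_pdivrMl//.
have : (I <= (e * eta)%:E)%E.
  have e20 : 0 < (e *+ 2)^-1 by rewrite invr_gt0 mulrn_wgt0.
  rewrite -(@lee_pmul2l _ ((e *+ 2)^-1)%:E)// ?lte_fin//.
  apply: (le_trans (ltW HI)); rewrite -EFinM lee_fin.
  rewrite (_ : _ * (e * eta) = eta / 2)//; field.
  by rewrite gt_eqF.
by move=> /(le_trans LI); rewrite lee_fin.
Unshelve. all: by end_near. Qed.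

End du_bois_reymond.

(** * Absolutely continuous representatives *)

Section weak_derivative_representation.
Context {R : realType}.
Notation mu := (@lebesgue_measure R).
Implicit Types (u v : R -> R) (Omega : set R).

Lemma small_right_integral v (a b x eta : R) : a < x -> x < b ->
  itg `[a, b]%classic v -> 0 < eta ->
  \forall e \near 0^'+, \int[mu]_(t in `[x, x + e]) `|v t| <= eta.
Proof.
move=> ax xb iv eta0; have ab : a <= b by rewrite ltW// (lt_trans ax).
have iN := itg_norm iv.
have cP := primitive_clamp_continuous ab iN.
have := cP x; move/cvgrPdist_le => /(_ _ eta0)/nbhs_ballP[d /= d0 Hd].
near=> e.
have e0 : 0 < e by near: e; exact: nbhs_right_gt.
have eb : x + e <= b by rewrite -lerBrDl; near: e; apply: nbhs_right_le; rewrite subr_gt0.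
have ed : e < d by near: e; exact: nbhs_right_lt.
have := Hd (x + e); rewrite /ball/= opprD addrA subrr sub0r normrN (gtr0_norm e0) => /(_ ed).
rewrite !clamp_id ?(ltW ax) ?(ltW xb) ?eb ?andbT//; last by rewrite (le_trans (ltW ax))// lerDl ltW.
have xxe : x <= x + e by rewrite lerDl ltW.
rewrite (@Rintegral_itv_add _ a (x + e) x)//; last 2 first.
- by rewrite (ltW ax).
- exact: itg_subitv iN.
rewrite opprD addrA subrr sub0r normrN; apply: le_trans; exact: ler_norm.
Unshelve. all: by end_near. Qed.

Lemma test_fun_ramps Omega (a b e x y : R) : 0 < e -> a <= x -> x <= y -> y + e <= b ->
  `[a, b]%classic `<=` Omega -> test_fun Omega (fun t => ramp e x t - ramp e y t).
Proof.
move=> e0 ax xy yb abO; split.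
  apply: nsmooth_smooth => n; apply: nsmoothD.
    by apply: nsmooth_affine; exact: nsmooth_sstep.
  apply: (@nsmooth_eq _ _ (fun t => (-1) * ramp e y t)); first by move=> t; rewrite mulN1r.
  by apply: nsmoothZ; apply: nsmooth_affine; exact: nsmooth_sstep.
exists `[x, y + e]%classic; split; first exact: segment_compact.
  by apply: subset_trans abO; exact: sub_itvcc.
move=> t /= /negP; rewrite in_itv/= negb_and -!ltNge => /orP[tx|ty].
  by rewrite !ramp_le ?subrr ?(ltW tx)// ltW// (lt_le_trans tx).
rewrite !ramp_ge ?subrr// ltW//; last by rewrite (le_lt_trans _ ty)// lerD2r.
Qed.

Lemma derive1_ramps (e x y t : R) :
  (fun t => ramp e x t - ramp e y t)^`()%classic t = dramp e x t - dramp e y t.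
Proof.
rewrite derive1E.
have d := is_deriveB (is_derive_ramp e x t) (is_derive_ramp e y t).
by have [] := d.
Qed.

Lemma weak_deriv_ramps Omega u v (a b e x y : R) :
  0 < e -> a <= x -> x <= y -> y + e <= b -> `[a, b]%classic `<=` Omega ->
  weak_deriv Omega u v ->
  \int[mu]_(t in `[a, b]) (u t * (dramp e x t - dramp e y t)) =
  - \int[mu]_(t in `[a, b]) (v t * (ramp e x t - ramp e y t)).
Proof.
move=> e0 ax xy yb abO [_ [_ H]].
have := H _ (test_fun_ramps e0 ax xy yb abO).
have out t : ~ `[a, b]%classic t -> (t < x) || (y + e < t).
  move=> /negP; rewrite /= in_itv/= negb_and -!ltNge => /orP[ta|bt].
    by rewrite (lt_le_trans ta).
  by rewrite (le_lt_trans yb bt) orbT.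
have restr (k : R -> R) : (forall t, (t < x) || (y + e < t) -> k t = 0) ->
    (\int[mu]_(t in Omega) (k t)%:E = \int[mu]_(t in `[a, b]) (k t)%:E)%E.
  move=> k0; rewrite integral_mkcond [RHS]integral_mkcond; congr integral.
  apply/funext => t; rewrite !patchE.
  have [tab|tab] := boolP (t \in `[a, b]%classic).
    by rewrite mem_set//; apply: abO; rewrite inE in tab.
  case: ifPn => // _; rewrite k0//; apply: out => tab'.
  by move: tab; rewrite mem_set.
rewrite !restr.
- move=> E; rewrite /Rintegral -fineN -E; congr fine; apply: eq_integral => t _.
  by rewrite derive1_ramps.
- move=> t tout; have yx : x + e <= y + e by rewrite lerD2r.
  case/orP: tout => [tx|ty].
    by rewrite !ramp_le ?subrr ?mulr0 ?(ltW tx)// ltW// (lt_le_trans tx).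
  by rewrite !ramp_ge ?subrr ?mulr0 ?(ltW ty)// ltW// (le_lt_trans _ ty).
- move=> t tout; rewrite derive1_ramps; have yx : x + e <= y + e by rewrite lerD2r.
  case/orP: tout => [tx|ty].
    by rewrite !dramp_eq0 ?subrr ?mulr0 ?tx// (lt_le_trans tx).
  by rewrite !dramp_eq0 ?subrr ?mulr0 ?ty ?orbT// (le_lt_trans _ ty) ?orbT.
Qed.

Lemma ramps_indic_dist (e x y t : R) : 0 < e -> x <= y ->
  `|ramp e x t - ramp e y t - \1_(`[x, y] : set (measurableTypeR R)) t| <=
  \1_(`[x, x + e] : set (measurableTypeR R)) t +
  \1_(`[y, y + e] : set (measurableTypeR R)) t.
Proof.
move=> e0 xy; have e0' := ltW e0.
rewrite !indicE !mem_setE !in_itv/=.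
have x0 := sstep_ge0 (e^-1 * t + - (e^-1 * x)).
have x1 := sstep_le1 (e^-1 * t + - (e^-1 * x)).
have y0 := sstep_ge0 (e^-1 * t + - (e^-1 * y)).
have y1 := sstep_le1 (e^-1 * t + - (e^-1 * y)).
rewrite -!/(ramp _ _ _) in x0 x1 y0 y1.
have [xt|tx] := leP x t; last first.
  have ty := lt_le_trans tx xy.
  rewrite !ramp_le ?(ltW tx) ?(ltW ty)// [y <= t]leNgt ty/= !subr0 normr0 addr0//.
have [yt|ty] := leP y t; last first.
  rewrite (ramp_le e0 (ltW ty)) subr0 (ltW ty)/=.
  have [te|et] := leP t (x + e); last by rewrite (ramp_ge e0 (ltW et)) subrr normr0 addr0.
  rewrite /= addr0 ler_norml; apply/andP; split; lra.
have [ye|ye] := leP t (y + e).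
  have r0 := ler0n R (t <= x + e)%R.
  apply: (@le_trans _ _ 1); last by rewrite lerDr.
  have [tey|tey] := leP t y; rewrite /= ?(ramp_le e0 tey) ler_norml;
    apply/andP; split; lra.
have yt' : y < t by rewrite (le_lt_trans _ ye)// lerDl.
have xe : x + e < t by rewrite (le_lt_trans _ ye)// lerD2r.
by rewrite !ramp_ge ?(ltW ye) ?(ltW xe)// subrr [t <= y]leNgt yt' /= subr0 normr0 addr_ge0.
Qed.

(* The test function is a smooth approximation of the indicator of [x, y]; its
   derivative averages [u] just to the right of the Lebesgue points x and y. *)
Lemma weak_deriv_increment Omega u v (a b x y : R) :
  `[a, b]%classic `<=` Omega -> weak_deriv Omega u v ->
  a < x -> x < y -> y < b ->
  lebesgue_pt (u \_ `[a, b]) x -> lebesgue_pt (u \_ `[a, b]) y ->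
  u y - u x = \int[mu]_(t in `[x, y]) v t.
Proof.
move=> abO uv ax xy yb lx ly.
have [lu [lv _]] := uv.
have iu : itg `[a, b]%classic u by exact: (lu _ (@segment_compact R a b)).
have iv : itg `[a, b]%classic v by exact: (lv _ (@segment_compact R a b)).
have xb := lt_trans xy yb; have ay := lt_trans ax xy.
have [C C0 HC] := @dsstep_bounded R.
apply/eqP; rewrite -subr_eq0 -normr_le0.
(* Each of the two mollified values of u costs C eta, and each of the two layers on which the ramps
   miss the indicator costs eta. *)
apply: (@ler_add_eps _ _ _ (2 * C + 2)); first by rewrite addr_ge0// mulr_ge0.
move=> eta eta0; rewrite add0r.
have [e [e0 ey eb [Lx Ly] [Vx Vy]]] : exists e, [/\ 0 < e, e <= y - x, y + e <= b,
    e^-1 * (\int[mu]_(t in `[x, x + e]) `|u t - u x|) <= eta /\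
    e^-1 * (\int[mu]_(t in `[y, y + e]) `|u t - u y|) <= eta &
    \int[mu]_(t in `[x, x + e]) `|v t| <= eta /\
    \int[mu]_(t in `[y, y + e]) `|v t| <= eta].
  near (0 : R)^'+ => e; exists e; split.
  - by near: e; exact: nbhs_right_gt.
  - by near: e; apply: nbhs_right_le; rewrite subr_gt0.
  - by rewrite -lerBrDl; near: e; apply: nbhs_right_le; rewrite subr_gt0.
  - split.
    + by near: e; exact: lebesgue_pt_right_average ax xb iu lx eta0.
    + by near: e; exact: lebesgue_pt_right_average ay yb iu ly eta0.
  - split.
    + by near: e; exact: small_right_integral ax xb iv eta0.
    + by near: e; exact: small_right_integral ay yb iv eta0.
have xe : x + e <= b by rewrite (le_trans _ eb)// lerD2r ltW.
have Mx := mollified_value HC e0 (ltW ax) xe iu.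
have My := mollified_value HC e0 (ltW ay) eb iu.
have W := weak_deriv_ramps e0 (ltW ax) (ltW xy) eb abO uv.
have iud z : itg `[a, b]%classic (fun t => u t * dramp e z t).
  have cd := @dramp_continuous R e z.
  have [M _ HM] := compact_continuous_bounded (@segment_compact R a b) cd.
  have := @itgM R _ _ _ M (measurable_itv _)
     (measurable_funTS (continuous_measurable_fun cd)) HM iu.
  by apply: eq_integrable => // t _ /=; rewrite mulrC.
have WE : \int[mu]_(t in `[a, b]) (u t * (dramp e x t - dramp e y t)) =
   \int[mu]_(t in `[a, b]) (u t * dramp e x t) - \int[mu]_(t in `[a, b]) (u t * dramp e y t).
  rewrite -RintegralB//; [|exact: iud|exact: iud].
  by apply: eq_Rintegral => t _; rewrite mulrBr.
have cr z : continuous (ramp e z).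
  move=> t; apply/differentiable_continuous/derivable1_diffP.
  by have [] := is_derive_ramp e z t.
have ivr : itg `[a, b]%classic (fun t => v t * (ramp e x t - ramp e y t)).
  have crr : continuous (fun t => ramp e x t - ramp e y t).
    by move=> t; apply: cvgB; exact: cr.
  have [M _ HM] := compact_continuous_bounded (@segment_compact R a b) crr.
  have := @itgM R _ _ _ M (measurable_itv _)
     (measurable_funTS (continuous_measurable_fun crr)) HM iv.
  by apply: eq_integrable => // t _ /=; rewrite mulrC.
have [i1 E1] := Rintegral_indicM (ltW ax) (ltW yb) iv.
have [i2 E2] := Rintegral_indicM (ltW ax) xe (itg_norm iv).
have [i3 E3] := Rintegral_indicM (ltW ay) eb (itg_norm iv).
have HV : `|\int[mu]_(t in `[a, b]) (v t * (ramp e x t - ramp e y t)) -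
    \int[mu]_(t in `[x, y]) v t| <= 2 * eta.
  rewrite -E1; apply: (@le_trans _ _ (\int[mu]_(t in `[a, b])
     (\1_(`[x, x + e] : set (measurableTypeR R)) t * `|v t| +
      \1_(`[y, y + e] : set (measurableTypeR R)) t * `|v t|))).
    apply: le_dist_Rintegral => //; first exact: itgD.
    move=> t _; rewrite [\1_(`[x, y] : set (measurableTypeR R)) t * _]mulrC.
    rewrite -mulrBr normrM mulrC -mulrDl.
    by rewrite ler_wpM2r// ramps_indic_dist// ltW.
  by rewrite RintegralD// E2 E3 mulr_natl mulr2n lerD.
move: W; rewrite WE.
have CX := ler_wpM2l C0 Lx; have CY := ler_wpM2l C0 Ly.
have {}Mx := le_trans Mx CX; have {}My := le_trans My CY.
move: Mx My HV.
set Ax := \int[mu]_(t in `[a, b]) (u t * dramp e x t).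
set Ay := \int[mu]_(t in `[a, b]) (u t * dramp e y t).
set V := \int[mu]_(t in `[a, b]) (v t * _).
set I := \int[mu]_(t in `[x, y]) v t.
clearbody Ax Ay V I; clear.
rewrite !ler_norml => /andP[? ?] /andP[? ?] /andP[? ?] ?.
apply/andP; split; lra.
Unshelve. all: by end_near. Qed.

(** By [weak_deriv_increment], u and the primitive of v differ by a constant on the Lebesgue points
    of the open interval, which have full measure. Any one of them, x0, fixes the constant. *)
Lemma weak_deriv_acpair Omega u v (a b : R) : a < b ->
  `[a, b]%classic `<=` Omega -> weak_deriv Omega u v ->
  exists2 w, acpair a b w v & {ae mu, forall x, `[a, b]%classic x -> u x = w x}.
Proof.
move=> ab abO uv; have [lu [lv _]] := uv; have abW := ltW ab.
have iu : itg `[a, b]%classic u by exact: (lu _ (@segment_compact R a b)).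
have iv : itg `[a, b]%classic v by exact: (lv _ (@segment_compact R a b)).
pose W x := \int[mu]_(t in `[a, clamp a b x]) v t.
have WB x y : a <= x -> x <= y -> y <= b -> W y - W x = \int[mu]_(t in `[x, y]) v t.
  move=> ax xy yb; rewrite /W !clamp_id ?ax ?yb ?(le_trans ax xy) ?(le_trans xy yb)//.
  rewrite (@Rintegral_itv_add _ a y x)//.
  - by rewrite addrC addKr.
  - by rewrite ax.
  - exact: itg_subitv iv.
have ael : {ae mu, forall x, lebesgue_pt (u \_ `[a, b]) x}.
  apply: lebesgue_differentiation; apply: open_integrable_locally; first exact: openT.
  exact: (itg_mkcond _ _).1.
have [x0 [ax0 x0b lx0]] : exists x0, [/\ a < x0, x0 < b & lebesgue_pt (u \_ `[a, b]) x0].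
  apply: contrapT => /forallNP H; case: ael => N [mN N0 HN].
  have abN : `]a, b[%classic `<=` N.
    move=> x; rewrite /= in_itv/= => /andP[ax xb]; apply: HN => /= lx.
    by apply: (H x).
  have : (mu `]a, b[%classic <= mu N)%E by rewrite le_measure// inE.
  by rewrite N0 lebesgue_measure_itv/= lte_fin ab -EFinB lee_fin subr_le0 leNgt ab.
have key x : a < x -> x < b -> lebesgue_pt (u \_ `[a, b]) x -> u x = u x0 + (W x - W x0).
  move=> ax xb lx; have [xx0|x0x|->] := ltgtP x x0; last by rewrite subrr addr0.
    have := weak_deriv_increment abO uv ax xx0 x0b lx lx0.
    rewrite -(WB _ _ (ltW ax) (ltW xx0) (ltW x0b)); lra.
  have := weak_deriv_increment abO uv ax0 x0x xb lx0 lx.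
  rewrite -(WB _ _ (ltW ax0) (ltW x0x) (ltW xb)); lra.
exists (fun x => u x0 + (W x - W x0)).
  split=> //.
  - move=> x; apply: cvgD; first exact: cvg_cst.
    apply: cvgB; last exact: cvg_cst.
    exact: primitive_clamp_continuous.
  - by move=> x y ax xy yb; rewrite -WB//; ring.
have aea : {ae mu, forall x, x != a}.
  exists [set a]; split=> //; first by rewrite lebesgue_measure_set1.
  by move=> x /= /negP; rewrite negbK => /eqP.
have aeb : {ae mu, forall x, x != b}.
  exists [set b]; split=> //; first by rewrite lebesgue_measure_set1.
  by move=> x /= /negP; rewrite negbK => /eqP.
have FF := ae_filter_ringOfSetsType mu.
have := @filterI _ _ FF _ _ ael (@filterI _ _ FF _ _ aea aeb).
apply: (@filterS _ _ FF) => x [lx [/= xa xb]]; rewrite /= in_itv/= => /andP[ax bx].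
apply: key => //; first by rewrite lt_neqAle ax eq_sym xa.
by rewrite lt_neqAle bx xb.
Qed.

End weak_derivative_representation.

(** * Passing from intervals to the open set *)

Section clamped_integrand.
Context {R : realType}.
Notation mu := (@lebesgue_measure R).
Implicit Types (u du w dw : R -> R) (Omega : set R) (f : R -> R -> R -> R).

(** The selected cells are numbered by their positions in [s]; they are disjoint because [s] has no
    repetition, and clamping fixes all their endpoints. *)
Lemma H4_equi_ac Omega f (a b : R) : `[a, b]%classic `<=` Omega -> H4 Omega f ->
  equi_ac a b (fun x s z => f (clamp a b x) s z).
Proof.
move=> abO h4 S M eta eta0.
have [delta delta0 Hd] := h4 `[a, b]%classic `[- S, S]%classic `[- M, M]%classic
  (@segment_compact R a b) abO (@segment_compact R _ _) (@segment_compact R _ _) _ eta0.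
exists delta => // c d ac cd db N t z s tS zM N0 us sN sd.
have cdW := ltW cd.
have h0 : 0 < (d - c) / N%:R by rewrite divr_gt0 ?subr_gt0// ltr0n.
have inN i : (i < size s)%N -> (nth 0%N s i < N)%N.
  by move=> ilt; exact: (allP sN _ (mem_nth _ ilt)).
have ptab i : (i <= N)%N -> a <= pt c d N i <= b.
  by move=> iN; rewrite (le_trans ac) ?pt_ge//= (le_trans _ db)// pt_le_end.
have Ht : `[- S, S]%classic t by rewrite /= in_itv/= -ler_norml.
have Hz : `[- M, M]%classic z by rewrite /= in_itv/= -ler_norml.
have := Hd t z Ht Hz (size s) (fun i => pt c d N (nth 0%N s i))
  (fun i => pt c d N (nth 0%N s i).+1).
rewrite (big_nth 0%N) big_mkord => H; apply/ltW.
have clE i : (i <= N)%N -> clamp a b (pt c d N i) = pt c d N i.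
  by move=> iN; rewrite clamp_id// ptab.
under eq_bigr => i _ do rewrite !clE ?inN// 1?ltnW ?inN//.
apply: H.
- move=> i ilt; have iN := inN _ ilt; split; first by rewrite -subr_gt0 ptS.
  have /andP[h1 _] := ptab _ (ltnW iN); have /andP[_ h2] := ptab _ iN.
  move=> x /=; rewrite !in_itv/= => /andP[x1 x2].
  by rewrite (le_trans h1 (ltW x1)) (le_trans (ltW x2) h2).
- move=> i j ilt jlt ij; apply/seteqP; split => // x [/=].
  rewrite !in_itv/= => /andP[x1 x2] /andP[x3 x4].
  have : nth 0%N s i != nth 0%N s j by rewrite nth_uniq//; exact/eqP.
  rewrite neq_ltn => /orP[lt|lt].
    have := pt_le N cdW lt => le; have := lt_trans (lt_le_trans x2 le) x3.
    by rewrite ltxx.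
  have := pt_le N cdW lt => le; have := lt_trans (lt_le_trans x4 le) x1.
  by rewrite ltxx.
under eq_bigr do rewrite ptS.
by rewrite sumr_const card_ord -[_ *+ size s]mulr_natl.
Qed.

(* Clamping [x] to [a, b] turns continuity within [Omega] into continuity on
   the whole space. *)
Lemma clamped_integrandP Omega f (a b : R) : a < b -> `[a, b]%classic `<=` Omega ->
  (forall x s xi, Omega x -> 0 <= f x s xi) -> H1 Omega f -> H4 Omega f ->
  integrand a b (fun x s z => f (clamp a b x) s z).
Proof.
move=> ab abO f0 [cf cvx] h4.
have clO x : Omega (clamp a b x).
  by apply: abO; rewrite /= in_itv/=; apply: clamp_in; exact: ltW.
split.
- apply: (@continuous_within_comp _ _ _ _ (fun p : R * R * R => f p.1.1 p.1.2 p.2)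
    (fun p : R * R * R => (clamp a b p.1.1, p.1.2, p.2)) _ _ cf) => [p|p]; last first.
    by split => //; split => //=.
  apply: (@cvg_pair _ _ _ _ (nbhs (clamp a b p.1.1, p.1.2)) (nbhs p.2)); last exact: cvg_snd.
  apply: (@cvg_pair _ _ _ _ (nbhs (clamp a b p.1.1)) (nbhs p.1.2)); last first.
    by apply: (continuous_comp cvg_fst); exact: cvg_snd.
  apply: (continuous_comp (f := fun p : R * R * R => p.1.1)).
    by apply: (continuous_comp cvg_fst); exact: cvg_fst.
  exact: clamp_continuous.
- by move=> x s z; exact: f0.
- by move=> x s y z t t01; exact: cvx.
- exact: H4_equi_ac h4.
Qed.

Lemma ae_eq_Rintegral (a b : R) (k1 k2 : R -> R) :
  measurable_fun (`[a, b] : set (measurableTypeR R)) k1 ->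
  measurable_fun (`[a, b] : set (measurableTypeR R)) k2 ->
  {ae mu, forall x, `[a, b]%classic x -> k1 x = k2 x} ->
  (\int[mu]_(x in `[a, b]) (k1 x)%:E = \int[mu]_(x in `[a, b]) (k2 x)%:E)%E.
Proof.
move=> m1 m2 H; apply: ae_eq_integral => //; [exact/measurable_EFinP..|].
by apply: (@filterS _ _ (ae_filter_ringOfSetsType mu)) H => x Hx xab; rewrite Hx.
Qed.

Lemma measurable_integrand Omega f u du (a b : R) : a < b -> `[a, b]%classic `<=` Omega ->
  (forall x s xi, Omega x -> 0 <= f x s xi) -> H1 Omega f -> H4 Omega f ->
  weak_deriv Omega u du ->
  measurable_fun (`[a, b] : set (measurableTypeR R)) (fun x => f x (u x) (du x)) /\
  forall M, measurable_fun (`[a, b] : set (measurableTypeR R)) (cut_integrand f M u du).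
Proof.
move=> ab abO f0 h1 h4 [lu [ldu _]].
have := clamped_integrandP ab abO f0 h1 h4.
set g := fun x s z => f (clamp a b x) s z; move=> [cg _ _ _].
have mu' := itg_measurable (lu _ (@segment_compact R a b) abO).
have mdu := itg_measurable (ldu _ (@segment_compact R a b) abO).
have mD : measurable (`[a, b]%classic : set (measurableTypeR R)) by [].
split.
  apply: eq_measurable_fun (@measurable_comp3 _ g _ _ _ mD cg mu' mdu).
  by move=> x; rewrite inE /= in_itv/= => /clamp_id xE; rewrite /g xE.
move=> M; apply: eq_measurable_fun (@measurable_cut_integrand _ g M _ _ _ mD cg mu' mdu).
by move=> x; rewrite inE /= in_itv/= => /clamp_id xE; rewrite /cut_integrand /g xE.
Qed.

(** Replacing u and w by their absolutely continuous representatives, and f by its clamped version,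
    changes none of the integrals. If the right-hand side is infinite there is nothing to prove. *)
Lemma weak_interval_lower_bound Omega f u du (a b M : R) : a < b -> 0 <= M ->
  `[a, b]%classic `<=` Omega ->
  (forall x s xi, Omega x -> 0 <= f x s xi) -> H1 Omega f -> H4 Omega f ->
  weak_deriv Omega u du ->
  itg `[a, b]%classic (cut_integrand f M u du) /\
  forall eta, 0 < eta -> exists2 C : R, 0 <= C & forall w dw, weak_deriv Omega w dw ->
  ((\int[mu]_(x in `[a, b]) cut_integrand f M u du x - eta -
     C * fine (\int[mu]_(x in `[a, b]) (`|w x - u x|)%:E))%:E <=
  \int[mu]_(x in `[a, b]) (f x (w x) (dw x))%:E)%E.
Proof.
move=> ab M0 abO f0 h1 h4 wu.
have igr := clamped_integrandP ab abO f0 h1 h4.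
set g := fun x s z => f (clamp a b x) s z in igr.
have [cg g0 _ _] := igr.
have gE x s z : `[a, b]%classic x -> g x s z = f x s z.
  by rewrite /= in_itv/= => xab; rewrite /g clamp_id.
have FF := ae_filter_ringOfSetsType mu.
have mD : measurable (`[a, b]%classic : set (measurableTypeR R)) by [].
have nonneg (k : R -> R) (D : set R) : (forall x, D x -> 0 <= k x) ->
    (\int[mu]_(x in D) `|(k x)%:E| = \int[mu]_(x in D) (k x)%:E)%E.
  by move=> k0; apply: eq_integral => x; rewrite inE => Dx; rewrite gee0_abs// lee_fin k0.
have [ub acu uE] := weak_deriv_acpair ab abO wu.
have [cu idu _] := acu.
have mub : measurable_fun (`[a, b] : set (measurableTypeR R)) ub.
  by apply: measurable_funTS; exact: continuous_measurable_fun.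
have mpsib := measurable_cut_integrand M mD cg mub (itg_measurable idu).
have [mfu /(_ M) mpsi] := measurable_integrand ab abO f0 h1 h4 wu.
have psiE : {ae mu, forall x, `[a, b]%classic x ->
    cut_integrand g M ub du x = cut_integrand f M u du x}.
  apply: (@filterS _ _ FF) uE => x ux xab.
  by rewrite /cut_integrand gE// ux.
have eqpsi := ae_eq_Rintegral mpsib mpsi psiE.
have ipsi : itg `[a, b]%classic (cut_integrand f M u du).
  (* Only integrability is extracted; the value 1 for eta is arbitrary. *)
  have [ipsib _] := interval_lower_bound ab M0 igr acu ltr01.
  apply/integrableP; split; first exact/measurable_EFinP.
  move/integrableP : ipsib => [_]; apply: le_lt_trans.
  rewrite !nonneg; first by rewrite eqpsi.
    by move=> x xab; rewrite /cut_integrand; case: ifP => // _; exact: g0.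
  by move=> x xab; rewrite /cut_integrand; case: ifP => // _; exact/f0/abO.
split=> // eta eta0.
have [_ [C C0 HC]] := interval_lower_bound ab M0 igr acu eta0.
exists C => // w dw ww.
have [wb acw wE] := weak_deriv_acpair ab abO ww.
have [cw idw _] := acw.
have mwb : measurable_fun (`[a, b] : set (measurableTypeR R)) wb.
  by apply: measurable_funTS; exact: continuous_measurable_fun.
have [mfw _] := measurable_integrand ab abO f0 h1 h4 ww.
have mgw := measurable_comp3 mD cg mwb (itg_measurable idw).
have fwE : {ae mu, forall x, `[a, b]%classic x -> g x (wb x) (dw x) = f x (w x) (dw x)}.
  by apply: (@filterS _ _ FF) wE => x wx xab; rewrite gE// wx.
rewrite -(ae_eq_Rintegral mgw mfw fwE).
have [lu [_ _]] := wu; have [lw [_ _]] := ww.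
have mw := itg_measurable (lw _ (@segment_compact R a b) abO).
have mu' := itg_measurable (lu _ (@segment_compact R a b) abO).
have mb : measurable_fun (`[a, b] : set (measurableTypeR R)) (fun x => `|wb x - ub x|).
  by apply: measurableT_comp => //; exact: measurable_funB.
have mo : measurable_fun (`[a, b] : set (measurableTypeR R)) (fun x => `|w x - u x|).
  by apply: measurableT_comp => //; exact: measurable_funB.
have nE : {ae mu, forall x, `[a, b]%classic x -> `|wb x - ub x| = `|w x - u x|}.
  by apply: (@filterS _ _ FF) (@filterI _ _ FF _ _ wE uE) => x [wx ux] xab; rewrite wx// ux.
rewrite -(ae_eq_Rintegral mb mo nE) /Rintegral -eqpsi.
have I0 : (0 <= \int[mu]_(x in `[a, b]) (g x (wb x) (dw x))%:E)%E.
  by apply: integral_ge0 => x _; rewrite lee_fin.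
have [Ify|] := ltP (\int[mu]_(x in `[a, b]) (g x (wb x) (dw x))%:E)%E +oo%E; last first.
  by rewrite leye_eq => /eqP ->; rewrite leey.
have ig : itg `[a, b]%classic (fun x => g x (wb x) (dw x)).
  apply/integrableP; split; first exact/measurable_EFinP.
  by rewrite nonneg.
have := HC wb dw acw ig.
by rewrite /Rintegral -lee_fin fineK// ge0_fin_numE.
Qed.

Lemma weak_interval_liminf Omega f u du us dus (a b M : R) : a < b -> 0 <= M ->
  `[a, b]%classic `<=` Omega ->
  (forall x s xi, Omega x -> 0 <= f x s xi) -> H1 Omega f -> H4 Omega f ->
  weak_deriv Omega u du -> (forall m, weak_deriv Omega (us m) (dus m)) ->
  L1loc_cvg Omega us u -> forall eta, 0 < eta ->
  \forall m \near \oo, ((\int[mu]_(x in `[a, b]) cut_integrand f M u du x - eta)%:E <=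
     \int[mu]_(x in `[a, b]) (f x (us m x) (dus m x))%:E)%E.
Proof.
move=> ab M0 abO f0 h1 h4 wu wus cus eta eta0.
have eta20 : 0 < eta / 2 by rewrite divr_gt0.
have [_ /(_ _ eta20)[C C0 HC]] := weak_interval_lower_bound ab M0 abO f0 h1 h4 wu.
have C1 : 0 < C + 1 by rewrite ltr_wpDl.
have e0 : 0 < eta / 2 / (C + 1) by rewrite divr_gt0.
have := cus _ (@segment_compact R a b) abO.
move=> /fine_cvgP[_ /cvgrPdist_le/(_ _ e0)] H.
near=> m.
apply: le_trans (HC _ _ (wus m)).
rewrite lee_fin -addrA lerD2l -opprD lerN2.
have : `|0 - fine (\int[mu]_(x in `[a, b]) (`|us m x - u x|)%:E)%E| <= eta / 2 / (C + 1).
  by near: m.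
rewrite sub0r normrN => /(le_trans (ler_norm _)) Hm.
rewrite [leRHS]splitr lerD2l (le_trans (ler_wpM2l C0 Hm))//.
by rewrite mulrCA ler_piMr ?(ltW eta20)// ler_pdivrMr// mul1r lerDl.
Unshelve. all: by end_near. Qed.

End clamped_integrand.

(** * Exhaustion of an open set by grid cells *)

Section exhaustion.
Context {R : realType}.
Notation mu := (@lebesgue_measure R).
Implicit Types (Omega : set R).

Lemma near_forall_seq (s : seq nat) (P : nat -> nat -> Prop) :
  (forall j, j \in s -> \forall m \near \oo, P j m) ->
  \forall m \near \oo, forall j, j \in s -> P j m.
Proof.
elim: s => [|i s IHs] H; first by apply: nearW.
have Hs : \forall m \near \oo, forall j, j \in s -> P j m.
  by apply: IHs => j js; apply: H; rewrite inE js orbT.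
have Hi : \forall m \near \oo, P i m by apply: H; rewrite inE eqxx.
near=> m => j; rewrite inE => /orP[/eqP ->|]; first by near: m.
by move: j; near: m.
Unshelve. all: by end_near. Qed.

Lemma limn_einf_ge (v : (\bar R)^nat) (y : \bar R) :
  (\forall m \near \oo, (y <= v m)%E) -> (y <= limn_einf v)%E.
Proof.
move=> [m0 _ Hm0]; rewrite limn_einf_lim.
rewrite (cvg_lim _ (@cvg_einfs_sup _ v))//.
apply: (@le_trans _ _ (einfs v m0)); last by apply: ereal_sup_ubound; exists m0.
by apply: le_ereal_inf_tmp => _ [m /= m0m <-]; exact: Hm0.
Qed.

Lemma limn_einf_le (v : (\bar R)^nat) (y : \bar R) :
  (forall m, (v m <= y)%E) -> (limn_einf v <= y)%E.
Proof.
move=> vy; rewrite limn_einf_lim (cvg_lim _ (@cvg_einfs_sup _ v))//.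
apply: ge_ereal_sup => _ [m _ <-]; apply: le_trans (vy m).
by apply: ereal_inf_lbound; exists m => /=.
Qed.

(** The number of cells is chosen to make the mesh 1 / (n + 1). *)
Definition grid (n j : nat) : R := pt (- n.+1%:R) n.+1%:R (2 * n.+1 ^ 2) j.

Definition grid_indices Omega (n : nat) : seq nat :=
  [seq j <- iota 0 (2 * n.+1 ^ 2) | `[< `[grid n j, grid n j.+1]%classic `<=` Omega >]].

(** Half-open for disjointness, whereas [grid_indices] tests the closed cell, to which the interval
    estimates apply. *)
Definition grid_cell (n j : nat) : set (measurableTypeR R) :=
  `[grid n j, grid n j.+1[%classic.

(** These sets need not increase with n, but each point of an open Omega lies in all but finitely
    many of them, which suits Fatou's lemma. *)
Definition grid_union Omega (n : nat) : set (measurableTypeR R) :=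
  \big[setU/set0]_(j <- grid_indices Omega n) grid_cell n j.

Lemma gridS n j : grid n j.+1 - grid n j = n.+1%:R^-1.
Proof.
rewrite /grid ptS natrM natrX; field.
by rewrite addrC natr1 pnatr_eq0.
Qed.

Lemma grid_lt n j : grid n j < grid n j.+1.
Proof. by rewrite -subr_gt0 gridS invr_gt0 ltr0n. Qed.

Lemma grid_le n i j : (i <= j)%N -> grid n i <= grid n j.
Proof. by move=> ij; apply: pt_le => //; rewrite -subr_ge0 opprK addr_ge0. Qed.

Lemma grid_cell_sub Omega n j : j \in grid_indices Omega n ->
  `[grid n j, grid n j.+1]%classic `<=` Omega.
Proof. by rewrite mem_filter => /andP[/asboolP]. Qed.

Lemma trivIset_grid_cell n (D : set nat) : trivIset D (grid_cell n).
Proof.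
apply/trivIsetP => i j _ _; rewrite neq_ltn => /orP[ij|ij].
  apply/seteqP; split=> // x []; rewrite /grid_cell /= !in_itv/= => /andP[_ x1] /andP[x2 _].
  by have := lt_le_trans x1 (le_trans (grid_le n ij) x2); rewrite ltxx.
apply/seteqP; split=> // x []; rewrite /grid_cell /= !in_itv/= => /andP[x2 _] /andP[_ x1].
by have := lt_le_trans x1 (le_trans (grid_le n ij) x2); rewrite ltxx.
Qed.

Lemma measurable_grid_cell n j : measurable (grid_cell n j).
Proof. exact: measurable_itv. Qed.

Lemma measurable_grid_union Omega n : measurable (grid_union Omega n).
Proof. by apply: bigsetU_measurable => j _; exact: measurable_grid_cell. Qed.

Lemma grid_union_sub Omega n : grid_union Omega n `<=` Omega.
Proof.
move=> x; rewrite /grid_union -bigcup_seq => -[j jI].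
rewrite /grid_cell /= in_itv/= => /andP[x1 x2].
by apply: (grid_cell_sub jI); rewrite /= in_itv/= x1 ltW.
Qed.

Lemma near_grid_union Omega x : open Omega -> Omega x ->
  \forall n \near \oo, grid_union Omega n x.
Proof.
move=> oO Ox.
have /nbhs_ballP[r /= r0 Hr] : nbhs x Omega by exact: open_nbhs_nbhs.
near=> n.
have n0 : 0 < n.+1%:R :> R by rewrite ltr0n.
have nr : n.+1%:R^-1 < r by near: n; exact: near_infty_natSinv_lt (PosNum r0).
have xn : `|x| < n.+1%:R.
  rewrite (@lt_le_trans _ _ n%:R)// ?ler_nat//; near: n; exact: nbhs_infty_gtr.
(* The distance from the left end of the grid to x, counted in cells; its integer part is the index
   of the cell containing x. *)
pose y := (x + n.+1%:R) * n.+1%:R.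
have xn0 : 0 <= x + n.+1%:R.
  by move: xn; rewrite ltr_norml => /andP[xn _]; rewrite -lerBlDr sub0r ltW.
have y0 : 0 <= y by rewrite mulr_ge0.
pose j := Num.truncn y.
have /andP[j1 j2] := truncn_itv y0.
have gE k : grid n k = - n.+1%:R + k%:R / n.+1%:R.
  rewrite /grid /pt natrM natrX; field.
  by rewrite addrC natr1 pnatr_eq0.
have g1 : grid n j <= x by rewrite gE addrC lerBlDr ler_pdivrMr.
have g2 : x < grid n j.+1 by rewrite gE addrC ltrBrDr ltr_pdivlMr.
rewrite /grid_union -bigcup_seq; exists j; last by rewrite /grid_cell/= in_itv/= g1.
rewrite /= mem_filter; apply/andP; split.
  apply/asboolP => z /=; rewrite in_itv/= => /andP[z1 z2]; apply: Hr.
  move: (gridS n j) nr g1 g2 z1 z2; rewrite /ball/= ltr_norml.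
  move: (grid n j) (grid n j.+1) (n.+1%:R^-1) => p q h.
  by clear => *; apply/andP; split; lra.
rewrite mem_iota add0n /= -(ltr_nat R) (le_lt_trans j1)// /y natrM natrX.
rewrite [X in _ < X](_ : _ = (n.+1%:R + n.+1%:R) * n.+1%:R); last by ring.
by rewrite ltr_pM2r// ltrD2r (le_lt_trans (ler_norm x)).
Unshelve. all: by end_near. Qed.

Lemma measurable_fun_grid_union Omega n (k : R -> R) :
  (forall j, j \in grid_indices Omega n ->
     measurable_fun (`[grid n j, grid n j.+1] : set (measurableTypeR R)) k) ->
  measurable_fun (grid_union Omega n) k.
Proof.
rewrite /grid_union; elim: (grid_indices Omega n) => [|i s IHs] H.
  by rewrite big_nil; exact: measurable_fun_set0.
have ms : measurable (\big[setU/set0]_(j <- s) grid_cell n j).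
  by apply: bigsetU_measurable => j _; exact: measurable_grid_cell.
rewrite big_cons; apply: (measurable_funU _ (measurable_grid_cell n i) ms).2.
split; last by apply: IHs => j js; apply: H; rewrite inE js orbT.
have := H i; rewrite inE eqxx => /(_ isT); apply: measurable_funS => //.
by apply: subset_itvl; rewrite bnd_simp.
Qed.

End exhaustion.

(** * Lower semicontinuity on the open set *)

Section lower_semicontinuity.
Context {R : realType}.
Notation mu := (@lebesgue_measure R).
Variables (Omega : set R) (f : R -> R -> R -> R).
Hypothesis oO : open Omega.
Hypothesis f0 : forall x s xi, Omega x -> 0 <= f x s xi.
Hypothesis h1 : H1 Omega f.
Hypothesis h4 : H4 Omega f.

Lemma measurable_Ffun_integrand (u du : R -> R) : weak_deriv Omega u du ->
  measurable_fun (Omega : set (measurableTypeR R)) (fun x => f x (u x) (du x)) /\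
  forall M, measurable_fun (Omega : set (measurableTypeR R)) (cut_integrand f M u du).
Proof.
move=> wu.
have OE : (Omega : set (measurableTypeR R)) = \bigcup_n grid_union Omega n.
  apply/seteqP; split => [x Ox|x [n _]]; last exact: grid_union_sub.
  have [n _ Hn] := near_grid_union oO Ox.
  by exists n => //; apply: Hn => /=.
have H n j : j \in grid_indices Omega n ->
   measurable_fun (`[grid n j, grid n j.+1] : set (measurableTypeR R))
      (fun x => f x (u x) (du x)) /\
   forall M, measurable_fun (`[grid n j, grid n j.+1] : set (measurableTypeR R))
      (cut_integrand f M u du).
  move=> jI; apply: measurable_integrand wu => //; first exact: grid_lt.
  exact: grid_cell_sub jI.
rewrite OE; split => [|M]; apply/measurable_fun_bigcup; try exact: measurable_grid_union.
  by move=> n; apply: measurable_fun_grid_union => j jI; have [] := H n j jI.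
by move=> n; apply: measurable_fun_grid_union => j jI; have [_] := H n j jI; apply.
Qed.

(** Finitely many cells share the error e, and their lower bounds hold together for all large m.
    Since f >= 0, dropping the rest of Omega only lowers F. *)
Lemma cut_integral_le_liminf (u du : R -> R) (us dus : nat -> R -> R) n :
  weak_deriv Omega u du -> (forall m, weak_deriv Omega (us m) (dus m)) ->
  L1loc_cvg Omega us u ->
  (\int[mu]_(x in grid_union Omega n) (cut_integrand f n%:R u du x)%:E <=
   limn_einf (fun m => Ffun f Omega (us m) (dus m)))%E.
Proof.
move=> wu wus cus.
set I := grid_indices Omega n.
have uI : uniq I by rewrite filter_uniq// iota_uniq.
have [_ mcut] := measurable_Ffun_integrand wu.
have mO : measurable (Omega : set (measurableTypeR R)) by exact: open_measurable.
have cut0 x : Omega x -> 0 <= cut_integrand f n%:R u du x.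
  by move=> Ox; rewrite /cut_integrand; case: ifP => // _; exact: f0.
have cellE (k : R -> R) : measurable_fun (Omega : set (measurableTypeR R)) k ->
    (forall x, Omega x -> 0 <= k x) ->
    (\int[mu]_(x in grid_union Omega n) (k x)%:E =
     \sum_(j <- I) \int[mu]_(x in `[grid n j, grid n j.+1]) (k x)%:E)%E.
  move=> mk k0; rewrite /grid_union ge0_integral_bigsetU//.
  - rewrite big_seq [RHS]big_seq; apply: eq_bigr => j jI.
    rewrite -integral_itv_bndo_bndc//; apply/measurable_EFinP.
    apply: measurable_funS mk => // x xj; apply: (grid_cell_sub jI).
    by move: xj; rewrite /= !in_itv/= => /andP[-> /ltW].
  - by move=> j; exact: measurable_grid_cell.
  - exact: trivIset_grid_cell.
  - apply/measurable_EFinP; apply: measurable_funS mk => //.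
    exact: grid_union_sub.
  - by move=> x /grid_union_sub Ox; rewrite lee_fin k0.
pose r j := \int[mu]_(x in `[grid n j, grid n j.+1]) cut_integrand f n%:R u du x.
have rE : (\int[mu]_(x in grid_union Omega n) (cut_integrand f n%:R u du x)%:E =
    (\sum_(j <- I) r j)%:E)%E.
  rewrite cellE// -sumEFin big_seq [RHS]big_seq; apply: eq_bigr => j jI.
  rewrite /r /Rintegral fineK//; apply: integrable_fin_num => //.
  have [ij _] := weak_interval_lower_bound (grid_lt n j) (ler0n R n)
    (grid_cell_sub jI) f0 h1 h4 wu.
  exact: ij.
rewrite rE; apply/lee_addgt0Pr => e e0; rewrite -leeBlDr// -EFinB.
apply: limn_einf_ge.
have s0 : 0 < (size I)%:R + 1 :> R by rewrite ltr_wpDl.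
have e1 : 0 < e / ((size I)%:R + 1) by rewrite divr_gt0.
have H := @near_forall_seq I (fun j m => ((r j - e / ((size I)%:R + 1))%:E <=
    \int[mu]_(x in `[grid n j, grid n j.+1]) (f x (us m x) (dus m x))%:E)%E)
  (fun j jI => weak_interval_liminf (grid_lt n j) (ler0n R n) (grid_cell_sub jI)
     f0 h1 h4 wu wus cus e1).
apply: filterS H => m Hm.
have [mF _] := measurable_Ffun_integrand (wus m).
have F0 x : Omega x -> 0 <= f x (us m x) (dus m x) by move=> Ox; exact: f0.
apply: (@le_trans _ _ (\int[mu]_(x in grid_union Omega n) (f x (us m x) (dus m x))%:E)%E).
  rewrite cellE//.
  apply: (@le_trans _ _ (\sum_(j <- I) (r j - e / ((size I)%:R + 1))%:E)%E); last first.
    by rewrite big_seq [leRHS]big_seq; apply: lee_sum => j; exact: Hm.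
  rewrite sumEFin lee_fin sumrB lerD2l lerN2.
  rewrite big_const_seq count_predT iter_addr_0 -[_ *+ size I]mulr_natl mulrCA.
  by rewrite ler_piMr ?(ltW e0)// ler_pdivrMr// mul1r lerDl.
apply: ge0_subset_integral => //.
- exact: measurable_grid_union.
- exact/measurable_EFinP.
- exact: grid_union_sub.
Qed.

End lower_semicontinuity.

Unset Implicit Arguments.

Theorem theorem1p5 (R : realType) (Omega : set R) (f : R -> R -> R -> R) :
  open Omega ->
  (forall x s xi, Omega x -> 0 <= f x s xi) ->
  H1 Omega f -> H4 Omega f ->
  forall (u du : R -> R) (us dus : nat -> R -> R),
    weak_deriv Omega u du ->
    (forall m, weak_deriv Omega (us m) (dus m)) ->
    L1loc_cvg Omega us u ->
    (Ffun f Omega u du <= limn_einf (fun m => Ffun f Omega (us m) (dus m)))%E.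
Proof.
move=> oO f0 h1 h4 u du us dus wu wus cus.
pose mu := @lebesgue_measure R.
have mO : measurable (Omega : set (measurableTypeR R)) by exact: open_measurable.
have [_ mcut] := measurable_Ffun_integrand oO f0 h1 h4 wu.
(* One index drives both the exhaustion and the cut level; at each point of Omega the sequence is
   eventually equal to the full integrand. *)
pose Psi n := (EFin \o cut_integrand f n%:R u du) \_ (grid_union Omega n).
have Psi0 n x : Omega x -> (0 <= Psi n x)%E.
  move=> Ox; rewrite /Psi patchE; case: ifP => // _; rewrite lee_fin /cut_integrand.
  by case: ifP => // _; exact: f0.
have mPsi n : measurable_fun (Omega : set (measurableTypeR R)) (Psi n).
  apply: (measurable_restrict _ (measurable_grid_union Omega n) mO).1.
  apply/measurable_EFinP; apply: (measurable_funS mO _ (mcut _)); exact: subIsetl.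
have PsiE x : Omega x -> limn_einf (Psi ^~ x) = (f x (u x) (du x))%:E.
  move=> Ox; suff /cvg_limn_einf_sup[] : Psi ^~ x @ \oo --> (f x (u x) (du x))%:E by [].
  apply: cvg_near_cst; near=> n; rewrite /Psi patchE mem_set.
    rewrite /= /cut_integrand ifT//; near: n; exact: nbhs_infty_ger.
  near: n; exact: near_grid_union.
rewrite /Ffun (@eq_integral _ _ _ mu _ (fun x => limn_einf (Psi ^~ x))); last first.
  by move=> x; rewrite inE => /PsiE ->.
(* Fatou's lemma acts in n; each term is bounded by the same lower limit in m. *)
apply: le_trans (fatou mu mO mPsi Psi0) _.
apply: limn_einf_le => n; rewrite /Psi -integral_mkcondr setIidr; last exact: grid_union_sub.
exact: cut_integral_le_liminf.
Unshelve. all: by end_near. Qed.
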